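(* Let $1<p,r<\infty$ and $0<q,\rho<\infty$ satisfy $p>q$ and $\frac1q=\frac1p+\frac1\rho$. Then there is a constant $C>0$, depending only on $n,p,q,r,\rho$, such that for every cube $Q\in\mathcal{Q}(\mathbb{R}^n)$ and every $f\in Lip(Q)$ the following hold. (1) If $q>1$, then for all $(w,v)\in\mathcal{A}^{r,r}_{p,q,\rho}(Q)$, $$\|v(f-f_Q)\|_{L^q(Q)}\le C\,[w,v]_{\mathcal{A}^{r,r}_{p,q,\rho}(Q)}\,\bigl\|w|\nabla f|\bigr\|_{L^p(Q)}.$$ (2) If $q\le1$, then for all $(w,v)\in\mathcal{A}^{r,1}_{p,q,\rho}(Q)$, $$\|v(f-f_Q)\|_{L^q(Q)}\le C\,[w,v]_{\mathcal{A}^{r,1}_{p,q,\rho}(Q)}\,\bigl\|w|\nabla f|\bigr\|_{L^p(Q)}.$$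
   Context: $\mathcal{Q}(\mathbb{R}^n)$ is the collection of all cubes in $\mathbb{R}^n$ with sides parallel to the coordinate axes; $\ell_Q$ is the side length of $Q$. $\mathcal{D}(Q)$ is the collection of all cubes obtained from $Q$ by finitely many (possibly zero) bisections, i.e. the dyadic subcubes of $Q$, including $Q$ itself. $f_Q=\frac{1}{|Q|}\int_Q f(x)\,dx$. $Lip(Q)$ is the family of all Lipschitz continuous functions on $Q$. A weight on $E\subset\mathbb{R}^n$ is a function $w\in L^1_{\rm loc}(E)$ (integrable on every compact subset of $E$) with $w(x)>0$ and $w(x)^{-1}>0$ for a.e. $x\in E$. $p'=p/(p-1)$. For $1<p<\infty$, $0<q<\infty$, $1\le r,\tilde r<\infty$, $0<\rho<\infty$, $\mathcal{A}^{r,\tilde r}_{p,q,\rho}(Q)$ is the family of all pairs $(w,v)$ of weights on $Q$ with $$[w,v]_{\mathcal{A}^{r,\tilde r}_{p,q,\rho}(Q)}:=\left(\sum_{R\in\mathcal{D}(Q)}\left[\frac{\ell_R}{|R|^{\frac1p-\frac1q}}\left(\frac1{|R|}\int_R w(x)^{-p'r}\,dx\right)^{\frac1{p'r}}\left(\frac1{|R|}\int_R v(x)^{q\tilde r}\,dx\right)^{\frac1{q\tilde r}}\right]^\rho\right)^{\frac1\rho}<\infty.$$ *)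

(* Defs.v *)
From HB Require Import structures.
From mathcomp Require Import all_boot all_order all_algebra.
From mathcomp Require Import all_classical all_reals all_analysis.

Set Implicit Arguments.
Unset Strict Implicit.
Unset Printing Implicit Defensive.
Import Order.TTheory GRing.Theory Num.Theory.
Import numFieldNormedType.Exports.

Local Open Scope classical_set_scope.
Local Open Scope ring_scope.

Section measurable_rV.
Context {R : realType} {n : nat}.

Definition rV_coord (i : 'I_n) (x : 'rV[R]_n) : R := x ord0 i.

Let rV_set0 : g_sigma_preimage rV_coord set0.
Proof. exact: sigma_algebra0. Qed.

Let rV_setC A : g_sigma_preimage rV_coord A ->
  g_sigma_preimage rV_coord (~` A).
Proof. exact: sigma_algebraC. Qed.

Let rV_bigcup (F : (set 'rV[R]_n)^nat) :
  (forall i, g_sigma_preimage rV_coord (F i)) ->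
  g_sigma_preimage rV_coord (\bigcup_i (F i)).
Proof. exact: sigma_algebra_bigcup. Qed.

(* The product sigma-algebra, i.e. the Borel sets of R^n. *)
HB.instance Definition _ := @isMeasurable.Build default_measure_display
  'rV[R]_n (g_sigma_preimage rV_coord) rV_set0 rV_setC rV_bigcup.

Lemma measurable_rV_coord (i : 'I_n) :
  measurable_fun [set: 'rV[R]_n] (rV_coord i).
Proof.
move=> _ Y mY; rewrite setTI; apply: sub_sigma_algebra.
rewrite -bigcup_seq/=; exists i; first by rewrite /= mem_index_enum.
by exists Y => //; rewrite setTI.
Qed.

Lemma measurable_fun_rV d (T : measurableType d) (f : T -> 'rV[R]_n) :
  (forall i, measurable_fun [set: T] (rV_coord i \o f)) ->
  measurable_fun [set: T] f.
Proof.
move=> mf _ A mA.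
have -> : [set: T] `&` f @^-1` A = f @^-1` A by rewrite setTI.
suff : g_sigma_preimage (fun i => rV_coord i \o f) `<=` measurable.
  apply; rewrite g_sigma_preimage_comp.
  by exists A => //; rewrite setTI.
apply: smallest_sub; first exact: sigma_algebra_measurable.
rewrite -bigcup_seq; apply: bigcup_sub => i _ _ [B mB <-].
exact: mf.
Qed.

End measurable_rV.

Section lebesgue_rV.
Context {R : realType}.

Definition rV_cons n (z : R * 'rV[R]_n) : 'rV[R]_n.+1 :=
  \row_i (if unlift ord0 i is Some j then z.2 ord0 j else z.1).

Definition rV_uncons n (x : 'rV[R]_n.+1) : R * 'rV[R]_n :=
  (x ord0 ord0, \row_j x ord0 (lift ord0 j)).

Lemma rV_consK n : cancel (@rV_cons n) (@rV_uncons n).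
Proof.
case=> a x; rewrite /rV_uncons /rV_cons mxE unlift_none; congr pair.
by apply/rowP => j; rewrite !mxE liftK.
Qed.

Lemma measurable_rV_cons n : measurable_fun [set: R * 'rV[R]_n] (@rV_cons n).
Proof.
apply: measurable_fun_rV => i; have [j ->|->] := unliftP ord0 i.
  rewrite (_ : _ \o _ = rV_coord j \o snd); last first.
    by apply/funext => z; rewrite /= /rV_coord mxE liftK.
  exact: measurableT_comp (measurable_rV_coord j) measurable_snd.
rewrite (_ : _ \o _ = fst); first exact: measurable_fst.
by apply/funext => z; rewrite /= /rV_coord mxE unlift_none.
Qed.

Lemma measurable_rV_uncons n : measurable_fun [set: 'rV[R]_n.+1] (@rV_uncons n).
Proof.
apply: measurable_fun_pair; first exact: (measurable_rV_coord ord0).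
apply: measurable_fun_rV => j.
rewrite (_ : _ \o _ = rV_coord (lift ord0 j)); first exact: measurable_rV_coord.
by apply/funext => x; rewrite /= /rV_coord mxE.
Qed.

(* Lebesgue measure on the Borel sets: R^(n+1) is identified with R * R^n and
   given the product measure. *)
Fixpoint lebesgue_borel n : set 'rV[R]_n -> \bar R :=
  match n with
  | 0 => \d_(0 : 'rV[R]_0)
  | m.+1 => pushforward (lebesgue_measure \x @lebesgue_borel m)%E (@rV_cons m)
  end.

Let sigma_finite_measureP d (T : measurableType d) (m : set T -> \bar R) :
  m set0 = 0%E -> (forall A, (0 <= m A)%E) -> semi_sigma_additive m ->
  sigma_finite [set: T] m ->
  exists mu : {sigma_finite_measure set T -> \bar R},
    m = mu :> (set T -> \bar R).
Proof.
move=> m0 m_ge0 m_add m_sf.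
pose M := isMeasure.Build _ _ _ m m0 m_ge0 m_add.
pose mM : {measure set T -> \bar R} := HB.pack m M.
pose S := @Measure_isSigmaFinite.Build _ _ _ mM m_sf.
pose mS : {sigma_finite_measure set T -> \bar R} := HB.pack m mM S.
by exists mS.
Qed.

Let lebesgue_borel_structure n :
  exists mu : {sigma_finite_measure set 'rV[R]_n -> \bar R},
    @lebesgue_borel n = mu :> (set 'rV[R]_n -> \bar R).
Proof.
elim: n => [|n [mu IH]] /=; first by exists \d_(0 : 'rV[R]_0).
rewrite IH; pose nu := Measure.clone _ _ _ (lebesgue_measure \x mu)%E _.
pose mc := @measurable_rV_cons n.
have map0 : pushforward nu (@rV_cons n) set0 = 0%E by exact: measure0.
have map_ge0 A : (0 <= pushforward nu (@rV_cons n) A)%E by exact: measure_ge0.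
have map_add : semi_sigma_additive (pushforward nu (@rV_cons n)).
  exact: measure_semi_sigma_additive.
have sf : sigma_finite [set: 'rV[R]_n.+1] (pushforward nu (@rV_cons n)).
  have /sigma_finiteP[F [FT ndF mF]] := sigma_finiteT (@lebesgue_measure R).
  have /sigma_finiteP[G [GT ndG mG]] := sigma_finiteT mu.
  exists (fun k => @rV_uncons n @^-1` (F k `*` G k)).
    apply/esym/seteqP; split => // x _.
    have [i _ Fi] : (\bigcup_i F i) (rV_uncons x).1 by rewrite -FT.
    have [j _ Gj] : (\bigcup_i G i) (rV_uncons x).2 by rewrite -GT.
    exists (maxn i j) => //; split.
    - by move: Fi; exact/subsetPset/ndF/leq_maxl.
    - by move: Gj; exact/subsetPset/ndG/leq_maxr.
  move=> k; have [mFk Fkoo] := mF k; have [mGk Gkoo] := mG k; split.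
    rewrite -[X in measurable X]setTI; apply: measurable_rV_uncons => //.
    exact: measurableX.
  rewrite /pushforward -comp_preimage (_ : _ \o _ = idfun); last first.
    by apply/funext => z /=; rewrite rV_consK.
  by rewrite /= product_measure1E// lte_mul_pinfty// ge0_fin_numE.
exact: sigma_finite_measureP.
Qed.

Let lebesgue_borel0 n : @lebesgue_borel n set0 = 0%E.
Proof. by have [mu ->] := lebesgue_borel_structure n; exact: measure0. Qed.

Let lebesgue_borel_ge0 n A : (0 <= @lebesgue_borel n A)%E.
Proof. by have [mu ->] := lebesgue_borel_structure n; exact: measure_ge0. Qed.

Let lebesgue_borel_semi_sigma_additive n :
  semi_sigma_additive (@lebesgue_borel n).
Proof.
have [mu ->] := lebesgue_borel_structure n.
exact: measure_semi_sigma_additive.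
Qed.

Let lebesgue_borel_sigma_finite n :
  sigma_finite [set: 'rV[R]_n] (@lebesgue_borel n).
Proof. by have [mu ->] := lebesgue_borel_structure n; exact: sigma_finiteT. Qed.


HB.instance Definition _ n := isMeasure.Build _ _ _ (@lebesgue_borel n)
  (lebesgue_borel0 n) (@lebesgue_borel_ge0 n)
  (@lebesgue_borel_semi_sigma_additive n).

HB.instance Definition _ n := @Measure_isSigmaFinite.Build _ _ _
  (@lebesgue_borel n) (lebesgue_borel_sigma_finite n).

Lemma measurable_box n (I : 'I_n -> interval R) :
  measurable [set x : 'rV[R]_n | forall i, x ord0 i \in I i].
Proof.
rewrite (_ : [set x | _] =
    \bigcap_(i in [set: 'I_n]) (rV_coord i @^-1` [set` I i])); last first.
  by apply/seteqP; split=> x /= h i; [move=> _; exact: h|exact: (h i)].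
apply: fin_bigcap_measurable => // i _.
by rewrite -[X in measurable X]setTI; exact: measurable_rV_coord.
Qed.

Lemma lebesgue_borel_box n (I : 'I_n -> interval R) :
  lebesgue_borel [set x | forall i, x ord0 i \in I i] =
  (\prod_(i < n) lebesgue_measure [set` I i])%E.
Proof.
elim: n I => [|n IH] I.
  by rewrite big_ord0 /= diracE mem_set//= => -[].
rewrite big_ord_recl -IH /= /pushforward.
rewrite [X in product_measure1 _ _ X](_ : _ = [set` I ord0] `*`
    [set x : 'rV[R]_n | forall i, x ord0 i \in I (lift ord0 i)]).
  by rewrite product_measure1E//; exact: measurable_box.
apply/seteqP; split=> -[a x] /=.
  move=> h; split; first by have := h ord0; rewrite mxE unlift_none.
  by move=> i; have := h (lift ord0 i); rewrite mxE liftK.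
by move=> [h1 h2] i; rewrite mxE; case: unliftP => [j ->|->] //; exact: h2.
Qed.

End lebesgue_rV.
Arguments lebesgue_borel : clear implicits.

(* Lebesgue measure on R^n, completed: the measurable sets of its domain are
   all the Lebesgue-measurable subsets of R^n. *)
Definition lebesgue_rV (R : realType) (n : nat) :
    {measure set caratheodory_type (lebesgue_borel R n)^*%mu -> \bar R} :=
  @completed_measure_extension _ _ _ (lebesgue_borel R n).

Section weighted_poincare.
Context {R : realType} {n : nat}.
Local Notation mu := (lebesgue_rV R n).

(* (a, l) with 0 < l stands for the closed cube
   [a_1, a_1 + l] x ... x [a_n, a_n + l]. *)
Definition cube : Type := ('rV[R]_n * R)%type.

Definition corner (Q : cube) : 'rV[R]_n := Q.1.

Definition side (Q : cube) : R := Q.2.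

Definition cube_set (Q : cube) : set 'rV[R]_n :=
  [set x | forall i, corner Q ord0 i <= x ord0 i <= corner Q ord0 i + side Q].

Definition volume (Q : cube) : R := fine (mu (cube_set Q)).

Lemma volumeE (Q : cube) : 0 < side Q -> volume Q = side Q ^+ n.
Proof.
move=> Q0; rewrite /volume.
pose I (i : 'I_n) := `[corner Q ord0 i, corner Q ord0 i + side Q].
have -> : cube_set Q = [set x | forall i, x ord0 i \in I i].
  by apply/seteqP; split=> x /= h i; have := h i; rewrite in_itv.
rewrite /= /completed_measure_extension /= measurable_mu_extE; last first.
  exact: measurable_box.
rewrite [X in fine X]lebesgue_borel_box.
under eq_bigr do
  rewrite lebesgue_measure_itv/= lte_fin ltrDl Q0 -EFinB addrAC subrr add0r.
by rewrite prodEFin/= prodr_const card_ord.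
Qed.

(* One of the 2^n cubes obtained by bisecting the sides of Q: the i-th
   coordinate ranges over the upper half of the side when i \in e. *)
Definition bisect (Q : cube) (e : {set 'I_n}) : cube :=
  (\row_i (corner Q ord0 i + (i \in e)%:R * (side Q / 2)), side Q / 2).

Inductive dyadic (Q : cube) : cube -> Prop :=
| dyadic_refl : dyadic Q Q
| dyadic_bisect P e : dyadic Q P -> dyadic Q (bisect P e).

Definition average (Q : cube) (f : 'rV[R]_n -> R) : R :=
  (volume Q)^-1 * \int[mu]_(x in cube_set Q) f x.

Definition eaverage (Q : cube) (f : 'rV[R]_n -> \bar R) : \bar R :=
  ((volume Q)^-1%:E * \int[mu]_(x in cube_set Q) f x)%E.

Definition Lq_norm (q : R) (E : set 'rV[R]_n) (f : 'rV[R]_n -> R) : \bar R :=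
  'N[mu]_q%:E[(EFin \o f) \_ E]%E.

(* Euclidean norm of the gradient. For f Lipschitz on a cube Q the partial
   derivatives exist at almost every point of Q; on the boundary of Q, which is
   a null set, they may depend on the values of f outside Q. *)
Definition norm_grad (f : 'rV[R]_n -> R) (x : 'rV[R]_n) : R :=
  Num.sqrt (\sum_(i < n) ('D_(delta_mx ord0 i) f x) ^+ 2).

(* For a real-valued w the condition 0 < (w x)^-1, i.e. w x < +oo, is implied by
   0 < w x. *)
Definition weight (E : set 'rV[R]_n) (w : 'rV[R]_n -> R) : Prop :=
  [/\ forall K : set 'rV[R]_n, compact K -> K `<=` E ->
        mu.-integrable K (EFin \o w) &
      {ae mu, forall x, E x -> 0 < w x /\ 0 < (w x)^-1}].

(* The quantity [w, v] for the class A^{r,s}_{p,q,rho}(Q). *)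
Definition A_const (p q r s rho : R) (Q : cube) (w v : 'rV[R]_n -> R) :
    \bar R :=
  let p' := p / (p - 1) in
  ((\esum_(P in dyadic Q)
      ((side P / volume P `^ (p^-1 - q^-1))%:E
       * eaverage P (fun x => (w x `^ (- (p' * r)))%:E) `^ (p' * r)^-1
       * eaverage P (fun x => (v x `^ (q * s))%:E) `^ (q * s)^-1) `^ rho)
    `^ rho^-1)%E.

Definition A_class (p q r s rho : R) (Q : cube) (w v : 'rV[R]_n -> R) : Prop :=
  [/\ weight (cube_set Q) w, weight (cube_set Q) v &
      (A_const p q r s rho Q w v < +oo)%E].

End weighted_poincare.
Arguments cube : clear implicits.

(* Main.v *)
Require Import Defs.
From HB Require Import structures.
From mathcomp Require Import all_boot all_order all_algebra.
From mathcomp Require Import all_classical all_reals all_analysis.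
From mathcomp Require Import measurable_realfun.
From mathcomp Require Import ring lra.

Set Implicit Arguments.
Unset Strict Implicit.
Unset Printing Implicit Defensive.
Import Order.TTheory GRing.Theory Num.Theory.
Import numFieldNormedType.Exports.

Local Open Scope classical_set_scope.
Local Open Scope ring_scope.

(** For a Lipschitz [f], write [F] for the length of its gradient, [m_P(F)] for the
    mean of [F] over a cube [P], [l_P] for the side of [P] and [f_P] for the mean
    of [f].

    The mean of [f] changes by at most [c l_P m_P(F)] when [P] is replaced by one of
    its children ([poincare_bisect]); at a point [x] of [Q] these changes telescope
    along the dyadic cubes containing [x], down to scale [l_Q / 2^N]. Select a cube
    whenever the mean of [F] has more than doubled since the last selected one
    ([stopping]). Between two selected cubes the means are at most twice that of the
    upper one and the sides decrease geometrically, so that, up to a term that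
    vanishes as [N] grows, [|f - f_Q|] is at most [4 c] times the sparse operator
    [S x = sum l_P m_P(F) 1_P(x)] over the selected [P] ([stopping_chain],
    [oscillation_le]). The selected cubes strictly below a given one have in total at
    most its volume ([stopping_packing]), hence they satisfy a Carleson embedding theorem
    ([carleson_embedding], [carleson_power_mean]): for [k < m], the sum of
    [|P| (m_P(phi^k))^(m/k)] is at most a constant times the integral of [phi^m].

    It remains to bound [v S] in [L^q] ([sparse_bound]). By Hoelder,
    [m_P(F) <= m_P(w^-sigma)^(1/sigma) m_P((w F)^kappa)^(1/kappa)] with
    [sigma = p' r] and [kappa] conjugate to [sigma]; [r > 1] makes [kappa < p]. If
    [a_P] is the bracket in the definition of the weight constant and
    [b_P = |P|^(1/p) m_P((w F)^kappa)^(1/kappa)], the powers of [|P|] match so that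
    - for [q <= 1], the integral of [(v S)^q] is at most the sum of [(a_P b_P)^q],
      since the [q]-th power of a sum is at most the sum of the [q]-th powers;
    - for [q > 1], that integral [X] equals the one of [v S h], [h = (v S)^(q-1)];
      a further Hoelder inequality on each cube (this uses the exponent [q r > q] of
      [v]) and the embedding for [h] give [X <= (sum (a_P b_P)^q)^(1/q) (C X)^(1/q')],
      and [X] is finite, so it can be absorbed.
    Finally Hoelder with [1/q = 1/rho + 1/p] bounds the sum of [(a_P b_P)^q] by
    [(sum a_P^rho)^(q/rho) (sum b_P^p)^(q/p)]: the first sum is part of the one that
    defines the weight constant, the second is again controlled by the embedding.

    The local inequality compares neighbouring children of [P] by translating one
    onto the other; the increment of [f] is integrated by dominated convergence of
    difference quotients ([integral_increment]). That the partial derivatives exist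
    almost everywhere follows by Fubini from the one-variable case
    ([lipschitz_ae_derivable]), a consequence of the Radon-Nikodym theorem. *)

(** * Real powers and finite sums *)

Section powR_sums.
Context {R : realType}.

Lemma powRVK (z c : R) : 0 <= z -> 0 < c -> (z `^ c^-1) `^ c = z.
Proof. by move=> z0 c0; rewrite -(powRrM z c^-1 c) mulVf ?gt_eqF// powRr1. Qed.

Lemma powRKV (z c : R) : 0 <= z -> 0 < c -> (z `^ c) `^ c^-1 = z.
Proof. by move=> z0 c0; rewrite -(powRrM z c c^-1) mulfV ?gt_eqF// powRr1. Qed.

(** Each summand [y] of a sum [T] is at most [T], so [(y/T)^q >= y/T]; the fractions
    [y/T] add up to 1. *)
Lemma le_powR_sum (I : Type) (s : seq I) (q : R) (x : I -> R) :
  0 < q -> q <= 1 -> (forall i, 0 <= x i) ->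
  (\sum_(i <- s) x i) `^ q <= \sum_(i <- s) x i `^ q.
Proof.
move=> q0 q1 x0; elim: s => [|i s IH]; first by rewrite !big_nil powR0 ?gt_eqF.
have S0 : 0 <= \sum_(j <- s) x j by apply: sumr_ge0.
rewrite !big_cons; apply: le_trans (lerD (lexx _) IH).
have [T0|T0] := eqVneq (x i + \sum_(j <- s) x j) 0.
  by rewrite T0 powR0 ?gt_eqF// addr_ge0 ?powR_ge0.
have Tp : 0 < x i + \sum_(j <- s) x j by rewrite lt_def T0 addr_ge0.
set T := x i + _ in T0 Tp *.
have h y : 0 <= y -> y <= T -> T `^ q * (y / T) <= y `^ q.
  move=> y0 yT; have [->|yn0] := eqVneq y 0.
    by rewrite mul0r mulr0 powR_ge0.
  rewrite {2}(_ : y = T * (y / T)); last by rewrite mulrCA mulfV ?mulr1.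
  rewrite powRM ?divr_ge0 ?(ltW Tp)// ler_wpM2l ?powR_ge0//.
  apply: ger1_powR => //; rewrite divr_gt0//= ?ler_pdivrMr ?mul1r//.
  by rewrite lt_def yn0.
have := lerD (h _ (x0 i) _) (h _ S0 _).
rewrite -mulrDr -mulrDl divff// mulr1; apply.
- by rewrite lerDl.
- by rewrite lerDr.
Qed.

Lemma hoelder_sum (I : Type) (s : seq I) (x y : I -> R) (a b : R) :
  (forall i, 0 <= x i) -> (forall i, 0 <= y i) ->
  0 < a -> 0 < b -> a^-1 + b^-1 = 1 ->
  \sum_(i <- s) x i * y i <=
  (\sum_(i <- s) x i `^ a) `^ a^-1 * (\sum_(i <- s) y i `^ b) `^ b^-1.
Proof.
move=> x0 y0 a0 b0 ab; elim: s => [|i s IH].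
  by rewrite !big_nil mulr_ge0 ?powR_ge0.
rewrite !big_cons; apply: le_trans (lerD (lexx _) IH) _.
set X := \sum_(j <- s) x j `^ a; set Y := \sum_(j <- s) y j `^ b.
have X0 : 0 <= X by apply: sumr_ge0 => *; exact: powR_ge0.
have Y0 : 0 <= Y by apply: sumr_ge0 => *; exact: powR_ge0.
have := hoelder2 (x0 i) (powR_ge0 X a^-1) (y0 i) (powR_ge0 Y b^-1) a0 b0 ab.
rewrite -> (powRVK X0 a0).
by rewrite -> (powRVK Y0 b0).
Qed.

(** Hoelder's inequality for exponents with [1/q = 1/a + 1/b], where [q] may be
    less than 1: the usual one applied to the [q]-th powers. *)
Lemma hoelder_sum_powR (I : Type) (s : seq I) (x y : I -> R) (q a b : R) :
  (forall i, 0 <= x i) -> (forall i, 0 <= y i) ->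
  0 < q -> 0 < a -> 0 < b -> q^-1 = a^-1 + b^-1 ->
  \sum_(i <- s) (x i * y i) `^ q <=
  (\sum_(i <- s) x i `^ a) `^ (q / a) * (\sum_(i <- s) y i `^ b) `^ (q / b).
Proof.
move=> x0 y0 q0 a0 b0 qab.
under eq_bigr do rewrite powRM//.
apply: le_trans (@hoelder_sum _ _ _ _ (a / q) (b / q) _ _ _ _ _) _.
- by move=> i; exact: powR_ge0.
- by move=> i; exact: powR_ge0.
- exact: divr_gt0.
- exact: divr_gt0.
- by rewrite !invf_div -mulrDr -qab divff ?gt_eqF.
rewrite !invf_div; have sumE (z : I -> R) c :
    \sum_(i <- s) (z i `^ q) `^ (c / q) = \sum_(i <- s) z i `^ c.
  apply: eq_bigr => i _.
  by rewrite -(powRrM (z i) q (c / q)) mulrC divfK ?gt_eqF.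
rewrite -> (sumE x), (sumE y).
exact: lexx.
Qed.

(** The joint convexity of the perspective [A^m D^(1-m)] of the power [A^m]; being
    homogeneous of degree one, it is subadditive. *)
Lemma perspective_powR_sum (I : finType) (A D : I -> R) (m : R) :
  1 < m -> (forall i, 0 <= A i) -> (forall i, 0 < D i) ->
  (\sum_i A i) `^ m * (\sum_i D i) `^ (1 - m) <=
  \sum_i A i `^ m * D i `^ (1 - m).
Proof.
move=> m1 A0 D0; have m0 : 0 < m by lra.
set X := \sum_i D i.
have X0 : 0 <= X by apply: sumr_ge0 => i _; exact: ltW.
set Z := \sum_i A i `^ m * D i `^ (1 - m).
have Z0 : 0 <= Z by apply: sumr_ge0 => i _; rewrite mulr_ge0 ?powR_ge0.
have [X00|Xn0] := eqVneq X 0.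
  by rewrite X00 powR0 ?mulr0//; lra.
have Xp : 0 < X by rewrite lt_def Xn0.
pose b := m / (m - 1).
have b0 : 0 < b by rewrite divr_gt0//; lra.
have mb : m^-1 + b^-1 = 1.
  by rewrite /b invf_div addrC mulrBl divff ?gt_eqF// mul1r subrK.
have H : \sum_i A i <= Z `^ m^-1 * X `^ b^-1.
  have := @hoelder_sum _ (index_enum I) (fun i => A i * D i `^ (- b^-1))
    (fun i => D i `^ b^-1) m b.
  have -> : \sum_i A i * D i `^ (- b^-1) * D i `^ b^-1 = \sum_i A i.
    apply: eq_bigr => i _; rewrite -mulrA -(powRD (x := D i)).
      by rewrite addNr powRr0 mulr1.
    by rewrite (gt_eqF (D0 i)) implybT.
  have -> : \sum_i (D i `^ b^-1) `^ b = X.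
    apply: eq_bigr => i _.
    by rewrite powRVK ?ltW.
  have -> : \sum_i (A i * D i `^ (- b^-1)) `^ m = Z.
    apply: eq_bigr => i _; rewrite powRM ?powR_ge0//.
    rewrite -(powRrM (D i) (- b^-1) m) (_ : - b^-1 * m = 1 - m)//.
    by rewrite /b invf_div mulNr divfK ?gt_eqF//; lra.
  by apply=> // i; rewrite ?mulr_ge0 ?powR_ge0 ?A0.
have : (\sum_i A i) `^ m <= (Z `^ m^-1 * X `^ b^-1) `^ m.
  by apply: ge0_ler_powR; rewrite ?nnegrE ?sumr_ge0 ?mulr_ge0 ?powR_ge0// ltW.
rewrite powRM ?powR_ge0// -(powRrM Z) -(powRrM X) mulVf ?gt_eqF// (powRr1 Z0).
rewrite (_ : b^-1 * m = m - 1); last by rewrite /b invf_div divfK ?gt_eqF.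
move=> h; apply: le_trans (ler_wpM2r (powR_ge0 _ _) h) _.
rewrite -mulrA -(powRD (x := X)) ?Xn0 ?implybT//.
by rewrite (_ : _ + _ = 0) ?powRr0 ?mulr1//; lra.
Qed.

Lemma powR_lt1_neg (a x : R) : 1 < a -> x < 0 -> a `^ x < 1.
Proof.
move=> a1 x0; rewrite /powR gt_eqF; last by lra.
rewrite -[X in _ < X]expR0 ltr_expR nmulr_rlt0// ln_gt0//; lra.
Qed.

Lemma powR_conj_mul (V X Y a b : R) : 0 <= V -> 0 <= X -> 0 <= Y ->
  a^-1 + b^-1 = 1 ->
  (V * X) `^ a^-1 * (V * Y) `^ b^-1 = V * (X `^ a^-1 * Y `^ b^-1).
Proof.
move=> V0 X0 Y0 ab; rewrite (powRM _ V0 X0) (powRM _ V0 Y0) mulrACA.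
by rewrite -(powRD (x := V)) ?ab ?(powRr1 V0)// oner_eq0.
Qed.

Lemma powR_mean (V I m : R) : 0 < V -> 0 <= I ->
  I `^ m * V `^ (1 - m) = V * (V^-1 * I) `^ m.
Proof.
move=> V0 I0; have Vi0 : 0 <= V^-1 by rewrite invr_ge0 ltW.
rewrite (powRM _ Vi0 I0) -(powR_inv1 (ltW V0)) -(powRrM V) mulrA [RHS]mulrC.
rewrite -{2}(powRr1 (ltW V0)) -(powRD (x := V)) ?(gt_eqF V0) ?implybT//.
by rewrite mulN1r.
Qed.

Lemma powR_le_1D (x a b : R) : 0 <= x -> 0 <= a -> a <= b ->
  x `^ a <= 1 + x `^ b.
Proof.
move=> x0 a0 ab; have [x1|x1] := leP 1 x.
  by apply: le_trans (ler_powR x1 ab) _; rewrite lerDr.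
apply: (@le_trans _ _ 1); last by rewrite lerDl powR_ge0.
have [->|xn0] := eqVneq x 0.
  by have [->|an0] := eqVneq a 0; rewrite ?powRr0 ?powR0.
by rewrite -(powRr0 x); apply: ger_powR; rewrite // lt_def xn0 x0 ltW.
Qed.

Lemma powRD_le (q a b : R) : 0 < q -> 0 <= a -> 0 <= b ->
  (a + b) `^ q <= 2 `^ q * (a `^ q + b `^ q).
Proof.
move=> q0; wlog ab : a b / a <= b => [H a0 b0|a0 b0].
  have [ab|/ltW ba] := leP a b; first exact: H.
  by rewrite addrC [X in _ * X]addrC; exact: H.
apply: (@le_trans _ _ ((2 * b) `^ q)).
  by apply: ge0_ler_powR; rewrite ?nnegrE ?(ltW q0)//; lra.
by rewrite (powRM q (ler0n _ 2) b0) ler_wpM2l ?powR_ge0// lerDr powR_ge0.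
Qed.

(** [a 2^(-N q)] tends to 0. *)
Lemma le_geometric_limit (X a B q : R) : 0 < q ->
  (forall N, X <= a * (2 ^+ N)^-1 `^ q + B) -> X <= B.
Proof.
move=> q0 H; pose z : R := (2^-1) `^ q.
have z0 : 0 <= z by exact: powR_ge0.
have z1 : z < 1.
  by rewrite /z -(powR_inv1 (ler0n R 2)) -(powRrM (2 : R)) mulN1r powR_lt1_neg; lra.
have zN N : (2 ^+ N)^-1 `^ q = z ^+ N.
  rewrite -exprVn -(powR_mulrn N (_ : 0 <= (2^-1 : R))) ?invr_ge0//.
  by rewrite -(powRrM (2^-1 : R)) mulrC (powRrM (2^-1 : R)) powR_mulrn.
have c1 : (fun N => a * z ^+ N + B) @ \oo --> a * 0 + B.
  apply: cvgD; last exact: cvg_cst.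
  by apply: cvgM; [exact: cvg_cst|apply: cvg_expr; rewrite ger0_norm].
rewrite mulr0 add0r in c1.
apply: (ler_cvg_to (cvg_cst X) c1); apply: nearW => N.
by rewrite -zN.
Qed.

End powR_sums.

(** * Stopping times on a tree *)

Section stopping_tree.
Context {R : realType} {T : Type} {E : finType}.
Variables (child : T -> E -> T) (u : T -> R).

(** The list of the selected nodes of depth less than [N] below [P], where [lam] is the
    value of [u] at the last selected ancestor, or an initial threshold. *)
Fixpoint stopping (N : nat) (lam : R) (P : T) : seq T :=
  if N is N'.+1 then
    let lam' := if 2 * lam < u P then u P else lam in
    (if 2 * lam < u P then [:: P] else [::]) ++
    flatten [seq stopping N' lam' (child P e) | e <- enum E]
  else [::].

Lemma big_stoppingS (N : nat) (lam : R) (P : T) (c : T -> R) :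
  \sum_(S <- stopping N.+1 lam P) c S =
  (if 2 * lam < u P then c P else 0) +
  \sum_e \sum_(S <- stopping N (if 2 * lam < u P then u P else lam) (child P e))
           c S.
Proof.
rewrite /= big_cat big_flatten big_map big_enum /=; congr (_ + _).
by case: ifP; rewrite ?big_cons big_nil ?addr0.
Qed.

Variable ok : T -> Prop.
Hypothesis ok_child : forall P e, ok P -> ok (child P e).

Lemma le_sum_stopping (c d : T -> R) (N : nat) (lam : R) (P : T) :
  (forall S, ok S -> c S <= d S) -> ok P ->
  \sum_(S <- stopping N lam P) c S <= \sum_(S <- stopping N lam P) d S.
Proof.
move=> cd; elim: N lam P => [|N IH] lam P okP; first by rewrite /= !big_nil.
rewrite !big_stoppingS lerD//; first by case: ifP => // _; exact: cd.
by apply: ler_sum => e _; apply: IH; exact: ok_child.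
Qed.

Lemma sum_stopping_ge0 (c : T -> R) (N : nat) (lam : R) (P : T) :
  (forall S, ok S -> 0 <= c S) -> ok P ->
  0 <= \sum_(S <- stopping N lam P) c S.
Proof.
move=> c0 okP; have := le_sum_stopping N lam c0 okP.
by rewrite big1_eq.
Qed.

Definition additive_on_tree (A : T -> R) :=
  forall P, ok P -> A P = \sum_e A (child P e).

Section packing.
Variables vol F : T -> R.
Hypothesis vol_gt0 : forall P, ok P -> 0 < vol P.
Hypothesis u_ge0 : forall P, ok P -> 0 <= u P.
Hypothesis FE : forall P, ok P -> F P = u P * vol P.
Hypothesis vol_add : additive_on_tree vol.
Hypothesis F_add : additive_on_tree F.

(** Below a selected [S] the value of [lam] is the mean of [F] over [S], so the first
    bound says that the selected cubes strictly below [S] have total volume at most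
    [vol S]. It is the form of the packing condition that passes from children to
    parents. *)
Lemma stopping_packing (N : nat) (lam : R) (P : T) : 0 <= lam -> ok P ->
  lam * (\sum_(S <- stopping N lam P) vol S) <= F P /\
  \sum_(S <- stopping N lam P) vol S <= 2 * vol P.
Proof.
elim: N lam P => [|N IH] lam P lam0 okP.
  rewrite /= big_nil mulr0; split; first by rewrite FE// mulr_ge0 ?u_ge0 ?ltW ?vol_gt0.
  by rewrite mulr_ge0 ?ltW ?vol_gt0.
have okc e : ok (child P e) by exact: ok_child.
rewrite big_stoppingS; case: ifPn => [lu|_].
- have u0 : 0 < u P by apply: le_lt_trans lu; rewrite mulr_ge0.
  set M := \sum_e _.
  have uM : M <= vol P.
    have : u P * M <= F P.
      rewrite F_add// mulr_sumr; apply: ler_sum => e _.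
      exact: (IH _ _ (ltW u0) (okc e)).1.
    by rewrite FE// ler_pM2l.
  have V0 := vol_gt0 okP.
  split; last by lra.
  rewrite FE//; have : lam * (vol P + M) <= lam * (2 * vol P).
    by rewrite ler_wpM2l//; lra.
  move/le_trans; apply; rewrite mulrA ler_pM2r//; lra.
- rewrite add0r; split.
    rewrite F_add// mulr_sumr; apply: ler_sum => e _; exact: (IH _ _ lam0 (okc e)).1.
  rewrite vol_add// mulr_sumr; apply: ler_sum => e _; exact: (IH _ _ lam0 (okc e)).2.
Qed.

(** The inverse of the relative gain at a selected node computed in
    [carleson_step]. *)
Definition carleson_const (m : R) : R :=
  (2 `^ (1 - m) * (1 - (3 / 2) `^ (1 - m)))^-1.

Lemma carleson_const_gt0 (m : R) : 1 < m -> 0 < carleson_const m.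
Proof.
move=> m1; rewrite invr_gt0 mulr_gt0 ?powR_gt0//.
by rewrite subr_gt0; apply: powR_lt1_neg; lra.
Qed.

(** As [D <= 2 V], one has [V + D >= 3/2 D], so that [D^(1-m)] drops by the fraction
    [1 - (3/2)^(1-m)] when [D] becomes [V + D], while [V^(1-m)] is at most
    [2^(m-1) D^(1-m)]. *)
Lemma carleson_step (m V D : R) : 1 < m -> 0 < V -> V <= D -> D <= 2 * V ->
  V `^ (1 - m) + carleson_const m * (V + D) `^ (1 - m) <=
  carleson_const m * D `^ (1 - m).
Proof.
move=> m1 V0 VD D2.
have D0 : 0 < D by lra.
have [a0 b0] : 0 < 2 * V /\ 0 < (3 / 2) * D by split; lra.
have anti x y : 0 < x -> x <= y -> y `^ (1 - m) <= x `^ (1 - m).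
  move=> x0 xy; have -> : 1 - m = - (m - 1) by lra.
  rewrite !powRN lef_pV2 ?posrE ?powR_gt0//; last by lra.
  apply: ge0_ler_powR; rewrite ?nnegrE//; lra.
have h1 := anti _ _ D0 D2.
have h2 : (V + D) `^ (1 - m) <= (3 / 2 * D) `^ (1 - m) by apply: anti => //; lra.
move: h1 h2; rewrite (powRM (x := 2)) ?(powRM (x := 3 / 2)); [|lra..].
have c0 := carleson_const_gt0 m1.
have : carleson_const m * (2 `^ (1 - m) * (1 - (3 / 2) `^ (1 - m))) = 1.
  rewrite mulVf// gt_eqF// -invr_gt0; exact: c0.
have := powR_lt1_neg (a := 3 / 2) (x := 1 - m).
set k := (3 / 2) `^ _; set t := 2 `^ _; set C := carleson_const m in c0 *.
move=> k1 Ctk h1 h2; have {}k1 : k < 1 by apply: k1; lra.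
have VP := powR_ge0 V (1 - m); set v := V `^ _ in VP h1 *.
set d := D `^ _ in h1 h2 *; set e := _ `^ (1 - m) in h2 *.
apply: (@le_trans _ _ (v + C * (k * d))); first by rewrite lerD2l ler_pM2l.
have : C * (1 - k) * (t * v) <= C * (1 - k) * d.
  by rewrite ler_wpM2l// mulr_ge0 ?(ltW c0)//; lra.
have -> : C * (1 - k) * (t * v) = v by transitivity (C * (t * (1 - k)) * v); [ring|rewrite Ctk mul1r].
move=> h; have -> : C * d = C * (1 - k) * d + C * (k * d) by ring.
by rewrite lerD2r.
Qed.

(** Carleson embedding. Both [A] and [Phi] are set functions, with
    [(A P / vol P)^m <= Phi P / vol P]; think of [A P] as the integral of [phi] over
    [P] and of [Phi P] as that of [phi^m]. With [D P] the volume of [P] plus that of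
    the selected cubes below, the Bellman function [Phi P - A P^m D P^(1-m)] is
    superadditive, and at a selected cube it gains a fixed multiple of
    [A P^m vol P^(1-m)] because [D P] is then comparable to [vol P]. *)
Lemma carleson_embedding (A Phi : T -> R) (m : R) : 1 < m ->
  (forall P, ok P -> 0 <= A P) ->
  (forall P, ok P -> A P `^ m * vol P `^ (1 - m) <= Phi P) ->
  additive_on_tree A -> additive_on_tree Phi ->
  forall N lam P, 0 <= lam -> ok P ->
  \sum_(S <- stopping N lam P) A S `^ m * vol S `^ (1 - m) <=
  carleson_const m * Phi P.
Proof.
move=> m1 A0 APhi A_add Phi_add N lam P lam0 okP.
have c0 := carleson_const_gt0 m1.
(* At a selected [P], [D] exceeds the sum of its values at the children by [vol P],
   otherwise it equals that sum. *)
pose D N lam P := vol P + \sum_(S <- stopping N lam P) vol S.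
have D_gt0 N' lam' P' : ok P' -> 0 <= lam' -> 0 < D N' lam' P'.
  move=> okP' lam'0; rewrite /D ltr_pwDl ?vol_gt0//.
  by apply: sum_stopping_ge0 => // S; move=> /vol_gt0 /ltW.
suff: \sum_(S <- stopping N lam P) A S `^ m * vol S `^ (1 - m) +
    carleson_const m * (A P `^ m * D N lam P `^ (1 - m)) <=
    carleson_const m * Phi P.
  apply: le_trans; rewrite lerDl mulr_ge0 ?(ltW c0)// mulr_ge0 ?powR_ge0//.
elim: N lam P lam0 okP => [|N IH] lam P lam0 okP.
  rewrite /D /= !big_nil add0r addr0 ler_pM2l//; exact: APhi.
have okc e : ok (child P e) by exact: ok_child.
rewrite big_stoppingS /D big_stoppingS.
set lam' := if _ then u P else _.
have lam'0 : 0 <= lam' by rewrite /lam'; case: ifP; rewrite ?u_ge0.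
set s := \sum_e \sum_(S <- _) (_ * _).
set v := \sum_e \sum_(S <- _) _.
have Dv : vol P + v = \sum_e D N lam' (child P e).
  by rewrite vol_add// -big_split.
have convex : A P `^ m * (vol P + v) `^ (1 - m) <=
    \sum_e A (child P e) `^ m * D N lam' (child P e) `^ (1 - m).
  rewrite Dv A_add//; apply: perspective_powR_sum => // e; first exact/A0.
  exact: D_gt0.
have main : s + carleson_const m * (A P `^ m * (vol P + v) `^ (1 - m)) <=
    carleson_const m * Phi P.
  rewrite Phi_add// mulr_sumr.
  apply: (@le_trans _ _ (s + carleson_const m *
     \sum_e A (child P e) `^ m * D N lam' (child P e) `^ (1 - m))).
    by rewrite lerD2l ler_pM2l.
  by rewrite mulr_sumr -big_split /=; apply: ler_sum => e _; exact: IH.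
case: ifPn => [lu|_]; last by rewrite !add0r.
have V0 := vol_gt0 okP.
have v_ge0 : 0 <= v.
  apply: sumr_ge0 => e _; apply: sum_stopping_ge0 => // S.
  by move=> /vol_gt0 /ltW.
have v_le : v <= vol P.
  have lamE : lam' = u P by rewrite /lam' lu.
  have u0 : 0 < u P by apply: le_lt_trans lu; rewrite mulr_ge0.
  rewrite -(ler_pM2l u0) -FE// F_add// mulr_sumr; apply: ler_sum => e _.
  by rewrite -lamE; exact: (stopping_packing N lam'0 (okc e)).1.
have step := carleson_step m1 V0 (_ : vol P <= vol P + v) (_ : _ <= 2 * vol P).
apply: le_trans main; rewrite addrAC addrC lerD2l.
have -> : A P `^ m * vol P `^ (1 - m) +
   carleson_const m * (A P `^ m * (vol P + (vol P + v)) `^ (1 - m)) =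
  A P `^ m * (vol P `^ (1 - m) +
     carleson_const m * (vol P + (vol P + v)) `^ (1 - m)) by ring.
rewrite [leRHS]mulrCA ler_wpM2l ?powR_ge0//; apply: step; lra.
Qed.

End packing.

(** Along the chain of cubes containing a point, the increments of [g] are summed
    against geometrically decreasing sides: those between two consecutive selected
    cubes are paid for by the upper one. *)
Lemma stopping_chain (side g : T -> R) (inc : T -> bool) (c K : R) :
  0 <= c ->
  (forall P, ok P -> 0 <= side P) ->
  (forall P, ok P -> 0 <= u P) ->
  (forall P e, ok P -> side (child P e) = side P / 2) ->
  (forall P, ok P -> inc P -> exists e, inc (child P e)) ->
  (forall P, ok P -> inc P -> g P <= K * side P) ->
  (forall P e, ok P -> inc P -> inc (child P e) ->
     g P <= g (child P e) + c * (side P * u P)) ->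
  forall N lam P, 0 <= lam -> ok P -> inc P ->
  g P <= K * (side P / 2 ^+ N) +
    4 * c * (\sum_(S <- stopping N lam P) side S * u S * (inc S)%:R
             + lam * side P).
Proof.
move=> c0 side0 u0 side_child inc_child gK gstep N.
elim: N => [|N IH] lam P lam0 okP incP.
  rewrite /= big_nil add0r expr0 divr1; apply: le_trans (gK _ okP incP) _.
  by rewrite lerDl !mulr_ge0 ?side0.
have [e ince] := inc_child _ okP incP.
have okc e' : ok (child P e') by exact: ok_child.
apply: le_trans (gstep _ e okP incP ince) _.
rewrite big_stoppingS; set lam' := if _ then u P else _.
have lam'0 : 0 <= lam' by rewrite /lam'; case: ifP; rewrite ?u0.
have {}IH := IH lam' _ lam'0 (okc e) ince.
set s := \sum_e \sum_(S <- _) _.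
have les : \sum_(S <- stopping N lam' (child P e)) side S * u S * (inc S)%:R <= s.
  rewrite /s (bigD1 e)//= lerDl sumr_ge0// => e' _.
  apply: sum_stopping_ge0 => // S okS.
  by rewrite !mulr_ge0 ?side0 ?u0 ?ler0n.
move: IH; rewrite side_child// => IH.
have -> : side P / 2 ^+ N.+1 = side P / 2 / 2 ^+ N.
  by rewrite exprS invfM mulrA.
set k := K * _ in IH *.
have l0 := side0 _ okP; have uP0 := u0 _ okP.
move: IH les; set S1 := \sum_(S <- _) _ => IH les.
apply: (@le_trans _ _ (k + 4 * c * (S1 + lam' * (side P / 2)) +
   c * (side P * u P))); first by rewrite lerD2r.
rewrite -[leLHS]addrA lerD2l.
have cs : 0 <= c * (s - S1) by rewrite mulr_ge0// subr_ge0.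
have c4 : 0 <= c * (lam * side P) by rewrite !mulr_ge0.
case: ifPn => [lu|]; rewrite /lam'.
  have cu : 0 <= c * (side P * u P) by rewrite !mulr_ge0.
  rewrite lu incP mulr1; lra.
move=> lu; rewrite (negbTE lu).
have cu : c * (side P * u P) <= c * (side P * (2 * lam)).
  by rewrite !ler_wpM2l// leNgt.
lra.
Qed.

End stopping_tree.

(** * Lipschitz functions of one variable *)

Section lipschitz_ae_derivable.
Context {R : realType}.
Local Notation mu := (@lebesgue_measure R).

(** A function whose increments are between 0 and those of the identity is the
    distribution function of a measure dominated by Lebesgue measure: the
    identity minus the function gives another such measure, and the two add up to
    Lebesgue measure. By Radon-Nikodym the function is an indefinite integral, hence
    a.e. derivable by Lebesgue's differentiation theorem. *)
Lemma ae_derivable_of_increment (g : R -> R) :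
  (forall x y, x <= y -> 0 <= g y - g x <= y - x) ->
  {ae mu, forall x, derivable g x 1}.
Proof.
move=> gP.
have nd_rc (k : R -> R) : (forall x y, x <= y -> 0 <= k y - k x <= y - x) ->
    nondecreasing k /\ right_continuous k.
  move=> kP; split=> [x y xy|].
    by rewrite -subr_ge0; case/andP: (kP _ _ xy).
  apply: right_continuousW => x; apply/cvgrPdist_le => /= e e0; near=> y.
  have xy : `|x - y| <= e by near: y; apply: cvgr_dist_le.
  apply: le_trans xy; have [xy|/ltW yx] := leP x y.
    have /andP[h1 h2] := kP _ _ xy.
    by rewrite distrC ger0_norm// distrC ger0_norm// subr_ge0.
  have /andP[h1 h2] := kP _ _ yx.
  by rewrite ger0_norm// ger0_norm// subr_ge0.
(* [g] and [h] are the distribution functions of two measures that add up to the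
   Lebesgue measure. *)
pose h x := x - g x.
have hP x y : x <= y -> 0 <= h y - h x <= y - x.
  by move=> /gP/andP[? ?]; rewrite /h; apply/andP; split; lra.
have [gnd grc] := nd_rc _ gP; have [hnd hrc] := nd_rc _ hP.
pose G : cumulative R R := HB.pack g (isCumulative.Build _ _ _ g gnd grc).
pose H : cumulative R R := HB.pack h (isCumulative.Build _ _ _ h hnd hrc).
pose nuG := lebesgue_stieltjes_measure G.
pose nuH := lebesgue_stieltjes_measure H.
have itvE (K : cumulative R R) (a b : R) : a <= b ->
    lebesgue_stieltjes_measure K `]a, b]%classic = (K b - K a)%:E.
  move=> ab; rewrite /lebesgue_stieltjes_measure.
  rewrite /measure_extension /= measurable_mu_extE /=; last exact: is_ocitv.
  by rewrite wlength_itv_bnd.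
have GH A : measurable A -> mu A = measure_add nuG nuH A.
  apply: lebesgue_measure_unique => X [[a b] _ <-] /=.
  rewrite [RHS](measure_addE nuG nuH).
  have [ab|/ltW ba] := leP a b.
    rewrite [LHS](itvE _ _ _ ab) [X in (X + _)%E](itvE _ _ _ ab).
    rewrite [X in (_ + X)%E](itvE _ _ _ ab) -EFinD; congr EFin.
    by rewrite /= /h; lra.
  by rewrite set_itv_ge ?bnd_simp -?leNgt// !measure0 adde0.
have nu_le A : measurable A -> (nuG A <= mu A)%E.
  by move=> mA; rewrite GH// [leRHS](measure_addE nuG nuH) leeDl.
pose D (k : nat) : set (measurableTypeR R) := `]- k%:R, k%:R]%classic.
have mD k : measurable (D k) by exact: measurable_itv.
have D_fin k : (nuG (D k) < +oo)%E.
  by rewrite /nuG /D itvE ?ltry// (le_trans _ (ler0n _ _))// oppr_le0 ler0n.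
suff ae_k : forall k : nat, {ae mu, forall x, `]- k%:R, k%:R[%classic x -> derivable g x 1}.
  have := ae_foralln ae_k; apply: filterS => x xk.
  apply: (xk (Num.truncn `|x|).+1); rewrite /= in_itv /=.
  by have := truncnS_gt `|x|; rewrite ltr_norml => /andP[-> ->].
move=> k.
pose nu : {finite_measure set (measurableTypeR R) -> \bar R} :=
  mfrestr (mD k) (D_fin k).
have nu_mu : nu `<< mu.
  move=> A A0 B mB BA; apply/eqP; rewrite eq_le measure_ge0 andbT.
  rewrite /nu /mfrestr /mrestr; apply: le_trans (nu_le _ (measurableI _ _ mB (mD k))) _.
  by rewrite (A0 _ (measurableI _ _ mB (mD k)) _)//; exact: subset_trans BA.
have [phi [phi0 phi_fin phi_int phiE]] := radon_nikodym_sigma_finite nu_mu.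
have phi_int' : mu.-integrable [set: R] (EFin \o (fine \o phi)).
  by apply: eq_integrable phi_int => // x _ /=; rewrite fineK.
have phi_intS (A : set R) : measurable A -> mu.-integrable A (EFin \o (fine \o phi)).
  by move=> mA; exact: integrableS phi_int'.
have := @FTC1 R (fine \o phi) (BRight (- k%:R)).
move=> /(_ (fun y => phi_intS _ (measurable_itv _))).
move=> /(_ (open_integrable_locally openT phi_int')).
apply: filterS; first exact: (ae_filter_ringOfSetsType mu).
move=> x xF; rewrite /= in_itv /= => /andP[kx xk].
have {xF} [+ _] := xF kx.
set F := fun y => _; have FE y : y \in `]- k%:R, k%:R[ -> F y = g y - g (- k%:R).
  rewrite in_itv /= => /andP[ky yk].
  rewrite /F /Rintegral; under eq_integral do rewrite fineK//.
  rewrite -phiE//= /nu /mfrestr /mrestr setIidl; last first.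
    move=> z; rewrite /D /= !in_itv /= => /andP[kz zy].
    by apply/andP; split=> //; exact: le_trans zy (ltW yk).
  by rewrite /nuG itvE ?ltW.
move=> dF; apply: (@near_eq_derivable _ _ _ (F + cst (g (- k%:R)))); last first.
  exact: derivableD dF (derivable_cst _ _ _).
have xin : x \in `]- k%:R, k%:R[ by rewrite in_itv /= kx xk.
near=> y; have yin : y \in `]- k%:R, k%:R[ by near: y; exact: near_in_itvoo.
by rewrite -[RHS](subrK (g (- k%:R))) -(FE _ yin).
Unshelve. all: by end_near. Qed.

(** Rescaling and adding a multiple of the identity reduces to increments between 0 and
    those of the identity. *)
Lemma lipschitz_ae_derivable (f : R -> R) (L : R) :
  (forall x y, `|f x - f y| <= L * `|x - y|) ->
  {ae mu, forall x, derivable f x 1}.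
Proof.
move=> fL; pose M := `|L| + 1; have M0 : 0 < M by rewrite ltr_wpDl.
have fM x y : `|f x - f y| <= M * `|x - y|.
  apply: le_trans (fL x y) _; rewrite ler_wpM2r// /M.
  by apply: le_trans (ler_norm L) _; rewrite lerDl.
pose g x := 2^-1 * (M^-1 * f x + x).
have : {ae mu, forall x, derivable g x 1}.
  apply: ae_derivable_of_increment => x y xy.
  have := fM y x; rewrite [in X in _ <= X]ger0_norm ?subr_ge0//.
  rewrite ler_norml => /andP[h1 h2].
  have Mf : M^-1 * (f y - f x) <= y - x.
    by rewrite mulrC ler_pdivrMr// mulrC.
  have Mf' : - (y - x) <= M^-1 * (f y - f x).
    by rewrite mulrC ler_pdivlMr// mulNr mulrC.
  by rewrite /g; apply/andP; split; lra.
apply: filterS; first exact: (ae_filter_ringOfSetsType mu).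
move=> x dg.
have -> : f = M *: (2 *: g - id).
  apply/funext => y; rewrite /g /= !fctE /=.
  rewrite /GRing.scale /=; field; exact: lt0r_neq0.
apply: derivableZ; apply: derivableB; [exact: derivableZ|exact: derivable_id].
Qed.

End lipschitz_ae_derivable.

(** * Lebesgue measure on row vectors *)

Section borel_measure.
Context {R : realType}.
Local Notation nu := (lebesgue_borel R).
Local Notation mu := (lebesgue_rV R).

(** Pushforwards as measures, to which the theorems on uniqueness of measures apply. *)
Lemma pushforward_is_measure d1 d2 (T1 : measurableType d1)
    (T2 : measurableType d2) (m : {measure set T1 -> \bar R}) (f : T1 -> T2) :
  measurable_fun [set: T1] f ->
  exists m' : {measure set T2 -> \bar R}, forall A, m' A = m (f @^-1` A).
Proof.
move=> mf; pose mM : {measure set T2 -> \bar R} := pushforward m f.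
by exists (mM mf).
Qed.

Lemma measurable_lebesgue_rV n (A : set 'rV[R]_n) : measurable A ->
  measurable (A : set (caratheodory_type (nu n)^*%mu)).
Proof. exact: caratheodory_measurable_mu_ext. Qed.

Lemma lebesgue_rVE n (A : set 'rV[R]_n) : measurable A -> mu n A = nu n A.
Proof. exact: measurable_mu_extE. Qed.

Lemma measurable_fun_lebesgue_rV n d (T : measurableType d) (f : 'rV[R]_n -> T) :
  measurable_fun [set: 'rV[R]_n] f ->
  measurable_fun [set: caratheodory_type (nu n)^*%mu] f.
Proof.
move=> mf _ Y mY; apply: measurable_lebesgue_rV; exact: mf.
Qed.

Lemma ge0_integral_lebesgue_rV n (D : set 'rV[R]_n) (f : 'rV[R]_n -> \bar R) :
  measurable D -> measurable_fun [set: 'rV[R]_n] f -> (forall x, (0 <= f x)%E) ->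
  (\int[mu n]_(x in D) f x = \int[nu n]_(x in D) f x)%E.
Proof.
move=> mD mf f0.
pose j (x : caratheodory_type (nu n)^*%mu) : 'rV[R]_n := x.
have mj : measurable_fun setT j.
  by move=> _ Y mY; rewrite setTI; exact: measurable_lebesgue_rV.
rewrite -[LHS](ge0_integral_pushforward mj (mu n)) //.
- apply: eq_measure_integral => A mA _.
  exact: lebesgue_rVE.
- exact: measurable_funTS.
Qed.

Lemma integral_lebesgue_rV n (D : set 'rV[R]_n) (f : 'rV[R]_n -> \bar R) :
  measurable D -> measurable_fun [set: 'rV[R]_n] f ->
  (\int[mu n]_(x in D) f x = \int[nu n]_(x in D) f x)%E.
Proof.
move=> mD mf; rewrite integralE [RHS]integralE; congr (_ - _)%E.
- apply: ge0_integral_lebesgue_rV => //; exact: measurable_funepos.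
- apply: ge0_integral_lebesgue_rV => //; exact: measurable_funeneg.
Qed.

Lemma lebesgue_measure_shift (a : R) (A : set R) : measurable A ->
  lebesgue_measure ((fun t => t + a) @^-1` A) = lebesgue_measure A.
Proof.
move=> mA.
have ms : measurable_fun [set: R] (fun t : R => t + a) by exact: measurable_funD.
have [m mE] := @pushforward_is_measure _ _ (measurableTypeR R) (measurableTypeR R)
  lebesgue_measure (fun t => t + a) ms.
rewrite -mE -(@lebesgue_measure_unique _ m) //= => X [[b c] _ <-] /=.
rewrite mE.
have -> : (fun t : R => t + a) @^-1` `]b, c] = `](b - a), (c - a)]%classic.
  by apply/seteqP; split => t /=; rewrite !in_itv /= ltrBlDr lerBrDr.
rewrite [LHS]lebesgue_measure_itv [RHS]lebesgue_measure_itv /= !lte_fin ltrD2r.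
by rewrite -!EFinB opprB addrA subrK.
Qed.

Lemma rV_consD n (z w : R * 'rV[R]_n) :
  rV_cons z + rV_cons w = rV_cons (z.1 + w.1, z.2 + w.2).
Proof.
by apply/rowP => i; rewrite !mxE; case: unliftP => [j _|_] //; rewrite !mxE.
Qed.

Lemma rV_unconsK n : cancel (@rV_uncons R n) (@rV_cons R n).
Proof.
move=> x; apply/rowP => i; rewrite !mxE; case: unliftP => [j ->|->] //=.
by rewrite mxE.
Qed.

Lemma measurable_fun_shift n (v : 'rV[R]_n) :
  measurable_fun [set: 'rV[R]_n] (fun x => x + v).
Proof.
apply: measurable_fun_rV => i.
rewrite (_ : _ \o _ = (fun x => rV_coord i x + v ord0 i)); last first.
  by apply/funext => x; rewrite /= /rV_coord mxE.
by apply: measurable_funD => //; exact: measurable_rV_coord.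
Qed.

(** By induction on the dimension: the image of the product measure under a translation
    agrees with it on rectangles. *)
Lemma lebesgue_borel_shift n (v : 'rV[R]_n) (A : set 'rV[R]_n) : measurable A ->
  nu n ((fun x => x + v) @^-1` A) = nu n A.
Proof.
elim: n v A => [|n IH] v A mA.
  by rewrite (_ : _ @^-1` _ = A)//; apply/seteqP; split=> x /=; rewrite !thinmx0.
pose w := rV_uncons v.
pose tau (z : measurableTypeR R * 'rV[R]_n) : measurableTypeR R * 'rV[R]_n :=
  (z.1 + w.1, z.2 + w.2).
have ms : measurable_fun [set: measurableTypeR R]
    (fun t : measurableTypeR R => t + w.1 : measurableTypeR R).
  have : measurable_fun [set: R] (fun t : R => t + w.1) by exact: measurable_funD.
  exact.
have mtau : measurable_fun setT tau.
  apply: measurable_fun_pair => /=.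
    exact: measurableT_comp ms measurable_fst.
  exact: measurableT_comp (measurable_fun_shift _) measurable_snd.
have mcA : measurable (@rV_cons R n @^-1` A).
  by rewrite -[X in measurable X]setTI; exact: measurable_rV_cons.
rewrite /= /pushforward.
have consE z : rV_cons z + v = rV_cons (tau z).
  by rewrite -{1}(rV_unconsK v) rV_consD.
have -> : @rV_cons R n @^-1` ((fun x => x + v) @^-1` A) =
    tau @^-1` (@rV_cons R n @^-1` A).
  by apply/seteqP; split => z; rewrite /= consE.
have [m mE] := pushforward_is_measure (lebesgue_measure \x nu n)%E mtau.
rewrite -mE -(@product_measure_unique _ _ _ _ R lebesgue_measure (nu n) m)//= => B C mB mC.
rewrite mE /=.
set B' := (fun t : measurableTypeR R => t + w.1) @^-1` B.
set C' := (fun x => x + w.2) @^-1` C.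
have mB' : measurable B' by rewrite -[X in measurable X]setTI; exact: ms.
have mC' : measurable C'.
  by rewrite -[X in measurable X]setTI; exact: measurable_fun_shift.
transitivity (lebesgue_measure B' * nu n C')%E; first exact: product_measure1E.
by rewrite IH//; congr (_ * _)%E; exact: lebesgue_measure_shift.
Qed.

Lemma ge0_integral_borel_shift n (v : 'rV[R]_n) (A : set 'rV[R]_n)
    (f : 'rV[R]_n -> \bar R) :
  measurable A -> measurable_fun [set: 'rV[R]_n] f -> (forall x, (0 <= f x)%E) ->
  (\int[nu n]_(x in A) f x =
   \int[nu n]_(x in (fun x => x + v)%R @^-1` A) f (x + v)%R)%E.
Proof.
move=> mA mf f0; have mv := measurable_fun_shift v.
rewrite -[RHS](ge0_integral_pushforward mv (nu n) mA (measurable_funTS mf))//.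
apply: eq_measure_integral => C mC _.
by symmetry; exact: (lebesgue_borel_shift v).
Qed.

Lemma integral_borel_shift n (v : 'rV[R]_n) (A : set 'rV[R]_n)
    (f : 'rV[R]_n -> \bar R) :
  measurable A -> measurable_fun [set: 'rV[R]_n] f ->
  (\int[nu n]_(x in A) f x =
   \int[nu n]_(x in (fun x => x + v)%R @^-1` A) f (x + v)%R)%E.
Proof.
move=> mA mf; rewrite integralE [RHS]integralE; congr (_ - _)%E.
- rewrite (ge0_integral_borel_shift v mA (measurable_funepos mf)) //.
  by apply: eq_integral => x _; rewrite !funeposE.
- rewrite (ge0_integral_borel_shift v mA (measurable_funeneg mf)) //.
  by apply: eq_integral => x _; rewrite !funenegE.
Qed.

(** Fubini for null sets: the lines parallel to a coordinate axis suffice. *)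
Lemma lebesgue_borel_null_lines n (i : 'I_n) (A : set 'rV[R]_n) : measurable A ->
  (forall x, lebesgue_measure [set t : R | A (x + t *: delta_mx ord0 i)] = 0%E) ->
  nu n A = 0%E.
Proof.
elim: n i A => [|n IH] i A mA A0; first by case: i A0.
have mcA : measurable (@rV_cons R n @^-1` A).
  by rewrite -[X in measurable X]setTI; exact: measurable_rV_cons.
rewrite /= /pushforward; have [j ij|i0] := unliftP ord0 i.
- rewrite /product_measure1 integral0_eq// => a _ /=.
  apply: (IH j); first exact: measurable_xsection.
  move=> x; rewrite -[RHS](A0 (rV_cons (a, x))); congr lebesgue_measure.
  have E t : rV_cons (a, x) + t *: delta_mx ord0 i =
      rV_cons (a, x + t *: delta_mx ord0 j).
    apply/rowP => l; rewrite !mxE /= ij; case: unliftP => [l' ->|->] /=.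
      by rewrite !mxE (inj_eq lift_inj).
    by rewrite mulr0 addr0.
  by apply/seteqP; split => t; rewrite /xsection /= inE /= E.
- rewrite (@product_measure_unique _ _ _ _ R lebesgue_measure (nu n)
    (lebesgue_measure \x^ nu n)%E _ _ mcA); last first.
    by move=> B C mB mC; exact: product_measure2E.
  apply: integral0_eq => x _ /=.
  rewrite -[RHS](A0 (rV_cons (0, x))); congr lebesgue_measure.
  have E t : rV_cons (0, x) + t *: delta_mx ord0 i = rV_cons (t, x).
    apply/rowP => l; rewrite !mxE /= i0; case: unliftP => [l' ->|->] /=.
      by rewrite mulr0 addr0.
    by rewrite mulr1 add0r.
  by apply/seteqP; split => t; rewrite /ysection /= inE /= E.
Qed.

End borel_measure.

(** * Difference quotients of Lipschitz functions *)

Section lipschitz_rV.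
Context {R : realType} {n : nat}.
Local Notation nu := (lebesgue_borel R n).
Implicit Types (f : 'rV[R]_n -> R) (x y : 'rV[R]_n) (L : R).

Lemma rV_norm_le x (r : R) : 0 <= r -> (forall i, `|x ord0 i| <= r) -> `|x| <= r.
Proof.
move=> r0 xr; rewrite -[`|x|]/(mx_norm x).
have [->//|/mx_norm_neq0 [[i j] /= ->]] := eqVneq (mx_norm x) 0.
by rewrite ord1.
Qed.

Lemma rV_coord_le_norm x i : `|x ord0 i| <= `|x|.
Proof.
rewrite -[`|x|]/(mx_norm x) mx_normrE.
exact: (le_bigmax _ (fun ij : 'I_1 * 'I_n => `|x ij.1 ij.2|) (ord0, i)).
Qed.

Lemma norm_delta_mx (i : 'I_n) : `|delta_mx ord0 i : 'rV[R]_n| <= 1.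
Proof.
apply: rV_norm_le => // j; rewrite mxE /=.
by case: (j == i); rewrite ?normr1 ?normr0.
Qed.

Lemma near_rat (h : R) (P : R -> Prop) :
  (\forall t \near h, P t) -> exists q : rat, P (ratr q).
Proof.
move=> [d /= d0 dP]; have [q] : exists q : rat, ratr q \in `]h - d, h + d[.
  by apply: rat_in_itvoo; rewrite ltrBlDr -addrA ltrDl addr_gt0.
rewrite in_itv /= => hq; exists q; apply: dP.
by rewrite /= distrC ltr_distl.
Qed.

Definition lipschitz_with L f := forall x y, `|f x - f y| <= L * `|x - y|.

(** A sublevel set is a countable union of rational boxes. *)
Lemma lipschitz_measurable f L : 0 <= L -> lipschitz_with L f ->
  measurable_fun [set: 'rV[R]_n] f.
Proof.
move=> L0 fL.
apply: (measurability _ (RGenInftyO.measurableE R)) => // _ [_ [c ->] <-].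
rewrite setTI.
pose center (qk : 'rV[rat]_n * nat) : 'rV[R]_n := \row_i ratr (qk.1 ord0 i).
pose rad (qk : 'rV[rat]_n * nat) : R := qk.2.+1%:R^-1.
have rad0 qk : 0 < rad qk by rewrite invr_gt0.
pose box qk : set 'rV[R]_n := [set x | forall i, x ord0 i \in
  `]center qk ord0 i - rad qk, center qk ord0 i + rad qk[].
have box_le qk x : box qk x -> `|x - center qk| <= rad qk.
  move=> bx; apply: rV_norm_le => [|i]; first exact: ltW.
  have := bx i; rewrite in_itv /= => /andP[h1 h2].
  by rewrite !mxE ler_norml; move: h1 h2; rewrite mxE => h1 h2; apply/andP; split; lra.
rewrite (_ : _ @^-1` _ = \bigcup_qk
  (if f (center qk) + L * rad qk < c then box qk else set0)).
  apply: countable_bigcupT_measurable => // qk; case: ifP => // _.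
  exact: measurable_box.
apply/seteqP; split => [x|x [qk _]] /=.
- rewrite in_itv /= => fxc.
  have cf0 : 0 < c - f x by rewrite subr_gt0.
  pose k := Num.truncn (2 * L / (c - f x)).
  have kP : 2 * L / k.+1%:R < c - f x.
    by rewrite ltr_pdivrMr// -ltr_pdivrMl// [ltLHS]mulrC truncnS_gt.
  have ex i : exists q : rat, ratr q \in `]x ord0 i - k.+1%:R^-1, x ord0 i + k.+1%:R^-1[.
    by apply: rat_in_itvoo; rewrite ltrBlDr -addrA ltrDl addr_gt0 ?invr_gt0.
  have [q qP] := choice ex.
  pose qk := (\row_i q i, k) : 'rV[rat]_n * nat.
  have bx : box qk x.
    move=> i; have := qP i; rewrite !in_itv /center /rad /= mxE /= mxE => /andP[h1 h2].
    by rewrite ltrBlDr h2 -ltrBlDr h1.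
  exists qk => //; rewrite ifT//.
  have h := le_trans (ler_norm _) (fL (center qk) x).
  have h2 : L * `|center qk - x| <= L * rad qk.
    by rewrite ler_wpM2l// distrC; exact: box_le.
  have {}kP : 2 * (L * rad qk) < c - f x by rewrite mulrA.
  move: h h2 kP; move: (L * rad qk) (L * _) (f (center qk)) (f x) => *; lra.
- case: ifP => // fc bx; rewrite in_itv /=; apply: le_lt_trans fc.
  have := le_trans (ler_norm _) (fL x (center qk)).
  have := ler_wpM2l L0 (box_le _ _ bx).
  move: (L * rad qk) (L * _) (f (center qk)) (f x) => *; lra.
Qed.

Definition diff_quotient f (i : 'I_n) (h : R) (x : 'rV[R]_n) : R :=
  h^-1 * (f (x + h *: delta_mx ord0 i) - f x).

Lemma measurable_diff_quotient f L i h : 0 <= L -> lipschitz_with L f ->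
  measurable_fun [set: 'rV[R]_n] (diff_quotient f i h).
Proof.
move=> L0 fL; have mf := lipschitz_measurable L0 fL.
apply: measurable_funM => //; apply: measurable_funB => //.
apply: (measurableT_comp mf); exact: measurable_fun_shift.
Qed.

Lemma lipschitz_axis f L i x (s t : R) : 0 <= L -> lipschitz_with L f ->
  `|f (x + s *: delta_mx ord0 i) - f (x + t *: delta_mx ord0 i)| <= L * `|s - t|.
Proof.
move=> L0 fL; apply: le_trans (fL _ _) _; rewrite ler_wpM2l//.
rewrite opprD addrACA subrr add0r -scalerBl normrZ.
by rewrite -[leRHS]mulr1 ler_wpM2l// norm_delta_mx.
Qed.

Lemma diff_quotient_le f L i h x : 0 <= L -> lipschitz_with L f ->
  `|diff_quotient f i h x| <= L.
Proof.
move=> L0 fL; rewrite normrM.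
have := lipschitz_axis i x h 0 L0 fL; rewrite scale0r addr0 subr0 => H.
have [->|h0] := eqVneq h 0; first by rewrite invr0 normr0 mul0r.
by rewrite normfV mulrC ler_pdivrMr// normr_gt0.
Qed.

(** By continuity in [h] it is enough to test rational increments, so that the set
    where the quotients are not Cauchy is a Borel set. *)
Definition nonderivable_set f (i : 'I_n) : set 'rV[R]_n :=
  \bigcup_(m : nat) \bigcap_(k : nat) \bigcup_(ab : rat * rat)
    (if (0 < `|ratr ab.1 : R| < k.+1%:R^-1) && (0 < `|ratr ab.2 : R| < k.+1%:R^-1)
     then [set x | m.+1%:R^-1 <
             `|diff_quotient f i (ratr ab.1) x - diff_quotient f i (ratr ab.2) x|]
     else set0).

Lemma measurable_nonderivable_set f L i : 0 <= L -> lipschitz_with L f ->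
  measurable (nonderivable_set f i).
Proof.
move=> L0 fL; apply: bigcupT_measurable => m; apply: bigcapT_measurable => k.
apply: countable_bigcupT_measurable => // -[a b] /=; case: ifP => // _.
set g := fun x => `|diff_quotient f i (ratr a) x - diff_quotient f i (ratr b) x|.
have mg : measurable_fun [set: 'rV[R]_n] g.
  by apply: measurableT_comp => //; apply: measurable_funB;
    exact: measurable_diff_quotient L0 fL.
rewrite (_ : [set x | _] = g @^-1` `]m.+1%:R^-1, +oo[%classic).
  by rewrite -[X in measurable X]setTI; exact: mg.
by apply/seteqP; split => x /=; rewrite in_itv /= andbT.
Qed.

Lemma derivable_axis f i x (t : R) :
  derivable (fun s : R => f (x + s *: delta_mx ord0 i)) t 1 <->
  derivable f (x + t *: delta_mx ord0 i) (delta_mx ord0 i).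
Proof.
rewrite /derivable; set F := (fun h : R => _ *: _); set G := (fun h : R => _ *: _).
suff -> : F = G by [].
apply/funext => h; rewrite /F /G /= /shift /=; congr (_ *: (f _ - _)).
transitivity (x + (h + t) *: delta_mx ord0 i).
  by congr (x + (_ + t) *: _); exact: mulr1.
by rewrite scalerDl addrCA.
Qed.

Lemma derivable_diff_quotient f i x :
  derivable f x (delta_mx ord0 i) <-> cvg (diff_quotient f i h x @[h --> 0^']).
Proof.
rewrite /derivable; set F := (fun h : R => _ *: _); set G := (fun h : R => _).
suff -> : F = G by [].
by apply/funext => h; rewrite /F /G /= /shift /= /diff_quotient (addrC x).
Qed.

(** The Cauchy criterion for the difference quotients. *)
Lemma nonderivable_setP f L i x : 0 <= L -> lipschitz_with L f ->
  derivable f x (delta_mx ord0 i) <-> ~ nonderivable_set f i x.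
Proof.
move=> L0 fL; rewrite derivable_diff_quotient; split.
- move=> /cvg_ex [l /cvgrPdist_le /= ql] [m _ /= H].
  have m0 : 0 < (2 * m.+1%:R)^-1 :> R by rewrite invr_gt0 mulr_gt0.
  have [d /= d0 dP] := ql _ m0.
  pose k := Num.truncn d^-1.
  have kd : k.+1%:R^-1 < d.
    by rewrite invf_plt ?posrE ?ltr0n// truncnS_gt.
  have [[a b] _ /=] := H k I; case: ifP => //= /andP[/andP[a0 ak] /andP[b0 bk]].
  apply/negP; rewrite -leNgt.
  have {}dP (h : R) : 0 < `|h| -> `|h| < k.+1%:R^-1 ->
      `|l - diff_quotient f i h x| <= (2 * m.+1%:R)^-1.
    move=> h0 hk; apply: dP; last by rewrite -normr_gt0.
    by rewrite /= sub0r normrN (lt_trans hk).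
  have := lerD (dP _ a0 ak) (dP _ b0 bk).
  have -> : (2 * m.+1%:R)^-1 + (2 * m.+1%:R)^-1 = m.+1%:R^-1 :> R.
    by rewrite invfM -mulr2n -[_ *+ 2]mulr_natl mulrA divff ?mul1r.
  apply: le_trans; rewrite (distrC l); apply: le_trans (ler_normD _ _).
  by rewrite addrA subrK.
- move=> Nx; apply/cauchy_cvgP/cauchy_exP => e e0.
  pose m := Num.truncn e^-1.
  have me : m.+1%:R^-1 < e.
    by rewrite invf_plt ?posrE ?ltr0n// truncnS_gt.
  have [k kP] : exists k : nat, forall a b : rat,
      0 < `|ratr a : R| < k.+1%:R^-1 -> 0 < `|ratr b : R| < k.+1%:R^-1 ->
      `|diff_quotient f i (ratr a) x - diff_quotient f i (ratr b) x|
        <= m.+1%:R^-1.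
    apply: contrapT => /forallNP H; apply: Nx; exists m => // k _.
    have := H k => /existsNP[a /existsNP[b]].
    move=> /not_implyP[ha /not_implyP[hb /negP]]; rewrite -ltNge => hab.
    by exists (a, b) => //=; rewrite ha hb.
  have [a] : exists q : rat, (ratr q : R) \in `]0, k.+1%:R^-1[.
    by apply: rat_in_itvoo; rewrite invr_gt0.
  rewrite in_itv /= => /andP[a0 ak].
  have aP : 0 < `|ratr a : R| < k.+1%:R^-1 by rewrite !gtr0_norm// a0.
  exists (diff_quotient f i (ratr a) x).
  exists (k.+1%:R^-1); first by rewrite /= invr_gt0.
  move=> h /=; rewrite sub0r normrN => hk h0.
  rewrite /ball /=; apply: le_lt_trans me.
  apply/ler_addgt0Pr => d d0.
  have hc : diff_quotient f i h' x @[h' --> h] --> diff_quotient f i h x.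
    apply: cvgM; first exact: cvgV.
    apply: cvgB; last exact: cvg_cst.
    have L1 : 0 < L + 1 by rewrite ltr_wpDl.
    apply/cvgrPdist_le => /= r r0; near=> h'.
    apply: le_trans (lipschitz_axis i x h h' L0 fL) _.
    apply: (@le_trans _ _ ((L + 1) * `|h - h'|)).
      by rewrite ler_wpM2r// lerDl.
    rewrite mulrC -ler_pdivlMr//; near: h'.
    by apply: cvgr_dist_le; [exact: cvg_id|exact: divr_gt0].
  have [b [b0 bk hb]] : exists b : rat, [/\ 0 < `|ratr b : R|,
      `|ratr b : R| < k.+1%:R^-1 &
      `|diff_quotient f i h x - diff_quotient f i (ratr b) x| <= d].
    apply: (@near_rat h (fun t => [/\ 0 < `|t|, `|t| < k.+1%:R^-1 &
      `|diff_quotient f i h x - diff_quotient f i t x| <= d])).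
    near=> h'; split.
    - rewrite normr_gt0; near: h'; exact: (@cvgr_neq0 _ _ _ _ _ id h).
    - near: h'; apply: (@cvgr_lt _ _ _ _ (fun t : R => `|t|) `|h|) => //.
      exact: norm_continuous.
    - near: h'; move/cvgrPdist_le : hc; exact.
  rewrite distrC.
  have := kP b a; rewrite b0 bk => /(_ isT aP) hba.
  have := lerD hba hb; apply: le_trans; rewrite [leRHS]addrC.
  apply: le_trans (ler_normD _ _); by rewrite addrA subrK.
Unshelve. all: by end_near. Qed.

End lipschitz_rV.

(** * Partial derivatives of Lipschitz functions *)

Section partial_derivative.
Context {R : realType} {n : nat}.
Local Notation nu := (lebesgue_borel R n).
Variables (f : 'rV[R]_n -> R) (L : R).
Hypotheses (L0 : 0 <= L) (fL : lipschitz_with L f).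
Implicit Type i : 'I_n.

(** On each line parallel to the axis the restriction of [f] is Lipschitz in one
    variable. *)
Lemma lebesgue_nonderivable_set i : nu (nonderivable_set f i) = 0%E.
Proof.
have mN := measurable_nonderivable_set i L0 fL.
apply: (lebesgue_borel_null_lines (i := i)) => // x.
set A := (X in lebesgue_measure X).
have mline : measurable_fun [set: R] (fun t : R => x + t *: delta_mx ord0 i).
  apply: measurable_fun_rV => j.
  rewrite (_ : _ \o _ = (fun t => x ord0 j + t * (delta_mx ord0 i : 'rV[R]_n) ord0 j)).
    by apply: measurable_funD => //; exact: measurable_funM.
  by apply/funext => t; rewrite /= /rV_coord !mxE.
have mA : measurable A.
  have := mline measurableT _ mN; rewrite setTI; exact.
apply: measure_negligible => //.
have := @lipschitz_ae_derivable R (fun t => f (x + t *: delta_mx ord0 i)) L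
  (fun s t => lipschitz_axis i x s t L0 fL).
apply: negligibleS => t /= Nt /derivable_axis /(nonderivable_setP _ _ L0 fL).
exact.
Qed.

(** Zero on the null set where the derivative may fail to exist, which makes it a Borel
    function. *)
Definition partial i (x : 'rV[R]_n) : R :=
  'D_(delta_mx ord0 i) f x * \1_(~` nonderivable_set f i) x.

Lemma cvg_diff_quotient i (x : 'rV[R]_n) (d : nat -> R) :
  (forall k, 0 < d k) -> d k @[k --> \oo] --> 0 -> ~ nonderivable_set f i x ->
  diff_quotient f i (d k) x @[k --> \oo] --> partial i x.
Proof.
move=> d0 dcvg Nx; rewrite /partial indicE mem_set// mulr1.
have dq : h^-1 *: ((f \o shift x) (h *: delta_mx ord0 i) - f x) @[h --> 0^'] -->
    'D_(delta_mx ord0 i) f x by exact: (nonderivable_setP i x L0 fL).2 Nx.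
have ddcvg : d k @[k --> \oo] --> 0^'.
  move=> A [e /= e0 eA].
  have /cvgrPdist_lt /(_ e e0) [N _ dN] := dcvg.
  by exists N => // k /dN dk; apply: eA; rewrite //= gt_eqF.
have -> : (fun k => diff_quotient f i (d k) x) =
    (fun h : R => h^-1 *: ((f \o shift x) (h *: delta_mx ord0 i) - f x)) \o d.
  by apply/funext => k; rewrite /= /shift /= /diff_quotient (addrC x).
exact: cvg_comp ddcvg dq.
Qed.

Lemma measurable_partial i : measurable_fun [set: 'rV[R]_n] (partial i).
Proof.
have mN := measurable_nonderivable_set i L0 fL.
pose h k x := diff_quotient f i k.+1%:R^-1 x * \1_(~` nonderivable_set f i) x.
apply: (@measurable_fun_cvg _ _ _ _ h) => [k|x _].
  apply: measurable_funM; first exact: measurable_diff_quotient L0 fL.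
  exact/measurable_indic/measurableC.
rewrite /h; have [Nx|Nx] := pselect (nonderivable_set f i x).
  rewrite /partial indicE memNset; last by move=> /(_ Nx).
  under eq_fun do rewrite mulr0; rewrite mulr0; exact: cvg_cst.
rewrite indicE mem_set//; under eq_fun do rewrite mulr1.
by apply: cvg_diff_quotient => //; exact: cvg_harmonic.
Qed.

Lemma partial_le i x : `|partial i x| <= L.
Proof.
have [Nx|Nx] := pselect (nonderivable_set f i x).
  rewrite /partial indicE memNset; last by move=> /(_ Nx).
  by rewrite mulr0 normr0.
have h0 (k : nat) : 0 < k.+1%:R^-1 :> R by rewrite invr_gt0.
apply/ler_addgt0Pr => e e0.
have /cvgrPdist_le /(_ e e0) [k _ kP] := cvg_diff_quotient h0 cvg_harmonic Nx.
have := kP k (leqnn k); rewrite -(lerD2l L); apply: le_trans.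
have := diff_quotient_le i k.+1%:R^-1 x L0 fL.
set q := diff_quotient _ _ _ _ => qL; apply: (@le_trans _ _ (`|q| + `|partial i x - q|)).
  by rewrite -{1}(subrK q (partial i x)) [leRHS]addrC; exact: ler_normD.
by rewrite lerD2r.
Qed.

(** The increment over a length [t] is split into [k] increments of length [t / k]
    based at translates of [A] that stay in [B]; after translating each back, what
    is left is [t] times the integral over [B] of the difference quotient of step
    [t / k], and dominated convergence applies. *)
Lemma integral_increment i (A B : set 'rV[R]_n) (t : R) : 0 < t ->
  measurable A -> measurable B -> (nu B < +oo)%E ->
  (forall x s, A x -> 0 <= s -> s <= t -> B (x + s *: delta_mx ord0 i)) ->
  (\int[nu]_(x in A) `|f (x + t *: delta_mx ord0 i) - f x|%:E
   <= t%:E * \int[nu]_(x in B) `|partial i x|%:E)%E.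
Proof.
move=> t0 mA mB Boo AB.
have mf := lipschitz_measurable L0 fL.
pose d (k : nat) := t / k.+1%:R.
have d0 k : 0 < d k by rewrite divr_gt0.
have dcvg : d k @[k --> \oo] --> 0.
  rewrite -(mulr0 t); apply: cvgM; [exact: cvg_cst|exact: cvg_harmonic].
pose phi k x := `|f (x + d k *: delta_mx ord0 i) - f x|.
have mshift (v : 'rV[R]_n) (g : 'rV[R]_n -> R) : measurable_fun [set: 'rV[R]_n] g ->
    measurable_fun [set: 'rV[R]_n] (fun x => g (x + v)).
  by move=> mg; exact: measurableT_comp mg (measurable_fun_shift _).
have mphi k : measurable_fun [set: 'rV[R]_n] (phi k).
  by apply: measurableT_comp => //; apply: measurable_funB => //; exact: mshift.
have shiftB k (j : nat) : (j <= k)%N ->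
    (\int[nu]_(x in A) (phi k (x + (j%:R * d k) *: delta_mx ord0 i))%:E
     <= \int[nu]_(x in B) (phi k x)%:E)%E.
  move=> jk; set v := (j%:R * d k) *: delta_mx ord0 i.
  pose B' := (fun x => x + - v) @^-1` A.
  have mB' : measurable B'.
    by rewrite -[X in measurable X]setTI; exact: measurable_fun_shift.
  have -> : (\int[nu]_(x in A) (phi k (x + v))%:E = \int[nu]_(x in B') (phi k x)%:E)%E.
    rewrite [RHS](ge0_integral_borel_shift v)//.
    - have <- : A = (fun x => x + v) @^-1` B'.
        by apply/seteqP; split=> x; rewrite /B' /= addrK.
      by [].
    - exact/measurable_EFinP.
    - by move=> x; rewrite lee_fin; exact: normr_ge0.
  apply: ge0_subset_integral => //.
    by apply/measurable_EFinP; exact: measurable_funTS.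
    by move=> x _; rewrite lee_fin; exact: normr_ge0.
  move=> x Ax; rewrite -(subrK v x); apply: (AB (x - v) (j%:R * d k)) => //.
    by rewrite mulr_ge0// ltW.
  by rewrite /d mulrCA ger_pMr// ler_pdivrMr// mul1r ler_nat leqW.
have bound k : (\int[nu]_(x in A) `|f (x + t *: delta_mx ord0 i) - f x|%:E
    <= t%:E * \int[nu]_(x in B) `|diff_quotient f i (d k) x|%:E)%E.
  have mphiv j : measurable_fun A
      (fun x => (phi k (x + (j%:R * d k) *: delta_mx ord0 i))%:E).
    by apply/measurable_EFinP/measurable_funTS; exact: mshift.
  apply: (@le_trans _ _ (\int[nu]_(x in A)
    (\sum_(j < k.+1) (phi k (x + (j%:R * d k) *: delta_mx ord0 i))%:E))%E).
    apply: ge0_le_integral => //=.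
    - by apply/measurable_EFinP/measurable_funTS/measurableT_comp => //;
        apply: measurable_funB => //; exact: mshift.
    - by apply: emeasurable_sum => j; exact: mphiv.
    - move=> x _; rewrite sumEFin lee_fin.
      pose u (j : nat) := f (x + (j%:R * d k) *: delta_mx ord0 i).
      have -> : f (x + t *: delta_mx ord0 i) - f x = \sum_(0 <= j < k.+1) (u j.+1 - u j).
        rewrite telescope_sumr// /u mul0r scale0r addr0; congr (f (x + _ *: _) - _).
        by rewrite /d mulrC divfK.
      rewrite big_mkord; apply: le_trans (ler_norm_sum _ _ _) _.
      apply: ler_sum => j _; rewrite /phi /u -addrA -scalerDl.
      by rewrite -natr1 mulrDl mul1r.
  rewrite ge0_integral_sum//; last first.
    by move=> j x _; rewrite lee_fin; exact: normr_ge0.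
  apply: (@le_trans _ _ (\sum_(j < k.+1) \int[nu]_(x in B) (phi k x)%:E)%E).
    by apply: lee_sum => j _; apply: shiftB; rewrite -ltnS.
  have -> (y : \bar R) m : (\sum_(j < m) y = m%:R%:E * y)%E.
    elim: m => [|m IH]; first by rewrite big_ord0 mul0e.
    rewrite big_ord_recr /= IH -{2}[y]mul1e -ge0_muleDl ?lee_fin//.
    by rewrite -EFinD natr1.
  have phiE x : (phi k x)%:E = ((d k)%:E * `|diff_quotient f i (d k) x|%:E)%E.
    rewrite -EFinM; congr EFin; rewrite /phi /diff_quotient normrM normfV.
    by rewrite (gtr0_norm (d0 k)) mulVKf// gt_eqF.
  under eq_integral do rewrite phiE.
  rewrite ge0_integralZl_EFin//; last 2 first.
  - apply/measurable_EFinP/measurable_funTS/measurableT_comp => //.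
    exact: measurable_diff_quotient L0 fL.
  - exact: ltW.
  by rewrite muleA -EFinM /d mulrC divfK.
have mdq k : measurable_fun B (fun x => `|diff_quotient f i (d k) x|%:E).
  apply/measurable_EFinP/measurable_funTS/measurableT_comp => //.
  exact: measurable_diff_quotient L0 fL.
have [_ _ dc] : [/\ nu.-integrable B (fun x => `|partial i x|%:E),
    (\int[nu]_(x in B) `| `|diff_quotient f i (d k) x|%:E - `|partial i x|%:E |)%E
      @[k --> \oo] --> 0%E &
    (\int[nu]_(x in B) `|diff_quotient f i (d k) x|%:E)%E @[k --> \oo] -->
       (\int[nu]_(x in B) `|partial i x|%:E)%E].
  apply: (@dominated_convergence _ _ _ nu B mB _ _ (cst L%:E)) => //.
  - apply/measurable_EFinP/measurable_funTS/measurableT_comp => //.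
    exact: measurable_partial.
  - exists (nonderivable_set f i); split.
    + exact: measurable_nonderivable_set L0 fL.
    + exact: lebesgue_nonderivable_set.
    + move=> x /= /not_implyP[_ xN]; apply: contrapT => Nx; apply: xN.
      apply: cvg_EFin; first exact: nearW.
      by apply: cvg_norm; exact: cvg_diff_quotient.
  - apply: (@measurable_bounded_integrable _ _ _ nu (cst L)) => //.
    exists L; split; first exact: num_real.
    by move=> M LM x _; rewrite /= ger0_norm// ltW.
  - by apply: aeW => x k _; rewrite /= lee_fin normr_id; exact: diff_quotient_le.
have tdc := cvgeZl (isT : t%:E \is a fin_num) dc.
by apply: cvge_ge tdc; exact: nearW.
Qed.

End partial_derivative.

(** * Cubes and their bisection *)

Section cubes.
Context {R : realType} {n : nat}.
Local Notation mu := (lebesgue_rV R n).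
Local Notation nu := (lebesgue_borel R n).
Local Notation side := (@side R n).
Local Notation corner := (@corner R n).
Local Notation cube_set := (@cube_set R n).
Local Notation volume := (@volume R n).
Local Notation bisect := (@bisect R n).
Implicit Types (P Q S : cube R n) (e : {set 'I_n}) (x : 'rV[R]_n).

Definition half_open P : set 'rV[R]_n :=
  [set x | forall i, corner P ord0 i <= x ord0 i < corner P ord0 i + side P].

Lemma half_open_subset P : half_open P `<=` cube_set P.
Proof. by move=> x Px i; have /andP[-> /ltW ->] := Px i. Qed.

Lemma side_bisect P e : side (bisect P e) = side P / 2.
Proof. by []. Qed.

Lemma corner_bisect P e i :
  corner (bisect P e) ord0 i = corner P ord0 i + (i \in e)%:R * (side P / 2).
Proof. by rewrite mxE. Qed.

Lemma cube_set_bisect P e : 0 < side P -> cube_set (bisect P e) `<=` cube_set P.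
Proof.
move=> P0 x /= xP i; have := xP i; rewrite corner_bisect side_bisect.
by case: (i \in e); rewrite ?mul1r ?mul0r => /andP[h1 h2]; apply/andP; split; lra.
Qed.

Lemma half_open_bisect P e : 0 < side P -> half_open (bisect P e) `<=` half_open P.
Proof.
move=> P0 x /= xP i; have := xP i; rewrite corner_bisect side_bisect.
by case: (i \in e); rewrite ?mul1r ?mul0r => /andP[h1 h2]; apply/andP; split; lra.
Qed.

Lemma cube_set_cover P x : cube_set P x -> exists e, cube_set (bisect P e) x.
Proof.
move=> xP; exists [set i | corner P ord0 i + side P / 2 <= x ord0 i]%SET => i.
rewrite corner_bisect side_bisect finset.in_set; have /andP[h1 h2] := xP i.
by have [h|h] := lerP (corner P ord0 i + side P / 2) (x ord0 i);
  rewrite ?mul1r ?mul0r; apply/andP; split; lra.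
Qed.

Lemma half_open_cover P x : half_open P x -> exists e, half_open (bisect P e) x.
Proof.
move=> xP; exists [set i | corner P ord0 i + side P / 2 <= x ord0 i]%SET => i.
rewrite corner_bisect side_bisect finset.in_set; have /andP[h1 h2] := xP i.
by have [h|h] := lerP (corner P ord0 i + side P / 2) (x ord0 i);
  rewrite ?mul1r ?mul0r; apply/andP; split; lra.
Qed.

Lemma half_open_bisect_inj P e1 e2 x : 0 < side P ->
  half_open (bisect P e1) x -> half_open (bisect P e2) x -> e1 = e2.
Proof.
move=> P0 x1 x2; apply/setP => i; have := x1 i; have := x2 i.
rewrite !corner_bisect !side_bisect.
by case: (i \in e1); case: (i \in e2); rewrite // ?mul1r ?mul0r => /andP[? ?] /andP[? ?]; lra.
Qed.

(** One family for the closed, half-open and open cubes: the half-open ones are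
    partitioned by bisection, the open ones are neighbourhoods of their points, and
    all differ by null sets. *)
Definition cube_itv (bl br : bool) P : set 'rV[R]_n :=
  [set x | forall i, x ord0 i \in Interval (BSide bl (corner P ord0 i))
                                      (BSide br (corner P ord0 i + side P))].

Lemma borel_cube_itv bl br P : measurable (cube_itv bl br P).
Proof. exact: measurable_box. Qed.

Lemma lebesgue_cube_itv bl br P : 0 < side P ->
  nu (cube_itv bl br P) = (side P ^+ n)%:E.
Proof.
move=> P0; rewrite [LHS]lebesgue_borel_box.
under eq_bigr do
  rewrite lebesgue_measure_itv/= lte_fin ltrDl P0 -EFinB addrAC subrr add0r.
by rewrite prodEFin/= prodr_const card_ord.
Qed.

Lemma half_openE P : half_open P = cube_itv true true P.
Proof. by apply/seteqP; split=> x /= h i; have := h i; rewrite in_itv. Qed.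

Lemma cube_setE P : cube_set P = cube_itv true false P.
Proof. by apply/seteqP; split=> x /= h i; have := h i; rewrite in_itv. Qed.

Lemma open_cube_subset P : cube_itv false true P `<=` cube_set P.
Proof. by move=> x Px i; have := Px i; rewrite in_itv /= => /andP[/ltW -> /ltW ->]. Qed.

Lemma borel_cube_set P : measurable (cube_set P : set 'rV[R]_n).
Proof. rewrite cube_setE; exact: borel_cube_itv. Qed.

Lemma borel_half_open P : measurable (half_open P : set 'rV[R]_n).
Proof. rewrite half_openE; exact: borel_cube_itv. Qed.

Lemma measurable_cube_set P :
  measurable (cube_set P : set (caratheodory_type (nu^*)%mu)).
Proof. by apply: measurable_lebesgue_rV; exact: borel_cube_set. Qed.

Lemma measurable_half_open P :
  measurable (half_open P : set (caratheodory_type (nu^*)%mu)).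
Proof. by apply: measurable_lebesgue_rV; exact: borel_half_open. Qed.

Lemma lebesgue_cube_set P : 0 < side P -> nu (cube_set P) = (side P ^+ n)%:E.
Proof. by move=> P0; rewrite cube_setE lebesgue_cube_itv. Qed.

Lemma lebesgue_cube_boundary bl br P : 0 < side P ->
  cube_itv bl br P `<=` cube_set P -> nu (cube_set P `\` cube_itv bl br P) = 0%E.
Proof.
move=> P0 sub; rewrite measureD //=.
- rewrite (setIidr sub) lebesgue_cube_set// lebesgue_cube_itv//.
  by rewrite subee.
- exact: borel_cube_set.
- exact: borel_cube_itv.
- by rewrite lebesgue_cube_set// ltry.
Qed.

Lemma volume_gt0 P : 0 < side P -> 0 < volume P.
Proof. by move=> P0; rewrite volumeE// exprn_gt0. Qed.

Lemma EFin_volume P : 0 < side P -> (volume P)%:E = mu (cube_set P).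
Proof.
move=> P0; rewrite volumeE// [RHS]lebesgue_rVE ?lebesgue_cube_set//.
exact: borel_cube_set.
Qed.

Lemma volume_bisect P e : 0 < side P -> volume (bisect P e) = volume P / 2 ^+ n.
Proof.
move=> P0; rewrite !volumeE ?side_bisect// ?divr_gt0//.
by rewrite expr_div_n.
Qed.

Lemma Rintegral_half_open P (phi : 'rV[R]_n -> R) : 0 < side P ->
  mu.-integrable (cube_set P) (EFin \o phi) ->
  \int[mu]_(x in cube_set P) phi x = \int[mu]_(x in half_open P) phi x.
Proof.
move=> P0 iphi; rewrite /Rintegral; congr fine.
have bN : measurable (cube_set P `\` half_open P : set 'rV[R]_n).
  by apply: measurableD; [exact: borel_cube_set|exact: borel_half_open].
have N0 : mu (cube_set P `\` half_open P) = 0%E.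
  rewrite [LHS]lebesgue_rVE //.
  by move: (@half_open_subset P); rewrite half_openE; exact: lebesgue_cube_boundary.
have := negligible_integral (measurable_lebesgue_rV bN) (measurable_cube_set P)
  iphi N0.
by rewrite setDD (setIidr (@half_open_subset P)).
Qed.

Lemma Rintegral_bisect P (phi : 'rV[R]_n -> R) : 0 < side P ->
  mu.-integrable (cube_set P) (EFin \o phi) ->
  \int[mu]_(x in cube_set P) phi x =
  \sum_e \int[mu]_(x in cube_set (bisect P e)) phi x.
Proof.
move=> P0 iphi; rewrite Rintegral_half_open//.
have iphie e : mu.-integrable (cube_set (bisect P e)) (EFin \o phi).
  apply: integrableS iphi; [exact: measurable_cube_set|exact: measurable_cube_set|].
  exact: cube_set_bisect.
have iphih e : mu.-integrable (half_open (bisect P e)) (EFin \o phi).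
  apply: integrableS (iphie e); [exact: measurable_cube_set|exact: measurable_half_open|].
  exact: half_open_subset.
have PE : half_open P = \big[setU/set0]_(e <- enum {set 'I_n}) half_open (bisect P e).
  rewrite -bigcup_seq; apply/seteqP; split=> [x /half_open_cover [e xe]|x [e _]].
    by exists e => //=; rewrite mem_enum.
  exact: half_open_bisect.
rewrite {1}/Rintegral PE integral_bigsetU_EFin//; last 4 first.
- by move=> e; exact: measurable_half_open.
- exact: enum_uniq.
- move=> e1 e2 _ _ [x [x1 x2]]; exact: half_open_bisect_inj P0 x1 x2.
- rewrite -PE; apply: measurable_int.
  by apply: integrableS iphi; [exact: measurable_cube_set|exact: measurable_half_open|exact: half_open_subset].
rewrite big_enum /= -sum_fine; last first.
  by move=> e _; apply: integrable_fin_num; [exact: measurable_half_open|exact: iphih].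
apply: eq_bigr => e _; rewrite Rintegral_half_open// side_bisect.
by rewrite divr_gt0.
Qed.

End cubes.

(** * Stopping cubes and the local Poincare inequality *)

Section dyadic_cubes.
Context {R : realType} {n : nat}.
Implicit Types (P Q S : cube R n) (e : {set 'I_n}).

Lemma dyadic_trans Q P S : dyadic Q P -> dyadic P S -> dyadic Q S.
Proof. by move=> QP; elim=> // S' e _ IH; exact: dyadic_bisect. Qed.

Lemma dyadic_side P S : dyadic P S -> 0 < side P -> 0 < side S /\ side S <= side P.
Proof.
move=> PS P0; elim: PS => // S' e _ [S0 SP].
by rewrite /side /=; rewrite -/(side S'); split; lra.
Qed.

Lemma dyadic_half_open P S : dyadic P S -> 0 < side P ->
  half_open S `<=` half_open P.
Proof.
move=> PS P0; elim: PS => // S' e PS' IH; apply: subset_trans IH.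
by apply: half_open_bisect; have [] := dyadic_side PS' P0.
Qed.

Lemma dyadic_cube_set P S : dyadic P S -> 0 < side P ->
  cube_set S `<=` cube_set P.
Proof.
move=> PS P0; elim: PS => // S' e PS' IH; apply: subset_trans IH.
by apply: cube_set_bisect; have [] := dyadic_side PS' P0.
Qed.

Lemma half_open_corner P : 0 < side P -> half_open P (corner P).
Proof. by move=> P0 i; rewrite lexx ltrDl. Qed.

Variable u : cube R n -> R.
Local Notation stopping := (stopping (@bisect R n) u).

Lemma stopping_dyadic N lam P S : S \in stopping N lam P -> dyadic P S.
Proof.
elim: N lam P => // N IH lam P /=; rewrite mem_cat => /orP[|].
  by case: ifP => //= _; rewrite inE => /eqP ->; exact: dyadic_refl.
move=> /flattenP[_ /mapP[e _ ->]] /IH; apply: dyadic_trans.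
exact: dyadic_bisect (dyadic_refl P).
Qed.

(** Distinct children of a cube have disjoint half-open parts, and the corner of a
    dyadic subcube lies in only one of them. *)
Lemma stopping_uniq N lam P : 0 < side P -> uniq (stopping N lam P).
Proof.
elim: N lam P => // N IH lam P P0 /=.
have Pe0 e : 0 < side (bisect P e) by rewrite side_bisect divr_gt0.
set lam' := if _ then u P else _.
rewrite cat_uniq; apply/and3P; split; first by case: ifP.
- apply/hasPn => S /flattenP[_ /mapP[e _ ->]] /stopping_dyadic /dyadic_side.
  move=> /(_ (Pe0 e)) [_]; rewrite side_bisect => SP.
  case: ifP => // _; rewrite mem_seq1; apply/eqP => SE; move: SP.
  by rewrite SE leNgt ltr_pdivrMr// ltr_pMr ?ltr1n.
- have := enum_uniq {set 'I_n}; elim: (enum _) => //= e es IHes /andP[ees ues].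
  rewrite cat_uniq IH// IHes// andbT /=; apply/hasPn => S /=.
  move=> /flattenP[_ /mapP[e' e'es ->]] Se'; apply/negP => Se.
  have hS (d : {set 'I_n}) : S \in stopping N lam' (bisect P d) ->
      half_open (bisect P d) (corner S).
    move=> /stopping_dyadic Sd; have [S0 _] := dyadic_side Sd (Pe0 d).
    exact: (dyadic_half_open Sd (Pe0 d)) (half_open_corner S0).
  have ee' := half_open_bisect_inj P0 (hS _ Se) (hS _ Se').
  by rewrite ee' e'es in ees.
Qed.

End dyadic_cubes.

Section lipschitz_cube.
Context {R : realType} {n : nat}.
Local Notation mu := (lebesgue_rV R n).
Local Notation nu := (lebesgue_borel R n).
Implicit Types (P Q S : cube R n) (e : {set 'I_n}) (x y : 'rV[R]_n).

(** Composing with the nearest-point retraction onto the cube. *)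
Lemma lipschitz_extension Q (f : 'rV[R]_n -> R) : 0 < side Q ->
  [lipschitz f x | x in cube_set Q] ->
  exists g : 'rV[R]_n -> R, exists2 L, 0 <= L &
    lipschitz_with L g /\ forall x, cube_set Q x -> g x = f x.
Proof.
move=> Q0 [M [_ fM]]; pose L := `|M| + 1.
have L0 : 0 <= L by rewrite addr_ge0.
have fL : L.-lipschitz_(cube_set Q) f by apply: fM; rewrite /L ltr_pwDr// ler_norm.
pose a i := corner Q ord0 i; pose b i := corner Q ord0 i + side Q.
have ab i : a i <= b i by rewrite lerDl ltW.
pose c x : 'rV[R]_n := \row_i Num.min (Num.max (x ord0 i) (a i)) (b i).
have cQ x : cube_set Q (c x).
  by move=> i; rewrite mxE -/(a i) -/(b i) le_min le_max lexx ab orbT /= ge_min lexx orbT.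
have cid x : cube_set Q x -> c x = x.
  move=> Qx; apply/rowP => i; rewrite mxE; have /andP[h1 h2] := Qx i.
  by rewrite max_l// min_l.
have clip x y : `|c x - c y| <= `|x - y|.
  apply: rV_norm_le => // i; rewrite !mxE.
  have := rV_coord_le_norm (x - y) i; rewrite !mxE; apply: le_trans.
  move: (x ord0 i) (y ord0 i) (a i) (b i) => s t p q.
  wlog st : s t / s <= t.
    by move=> H; have [/H//|/ltW/H] := leP s t; rewrite distrC (distrC s).
  rewrite [leRHS]distrC (ger0_norm (_ : 0 <= t - s)) ?subr_ge0// ler_norml.
  rewrite /Num.min /Num.max.
  by have [?|?] := ltP s p; have [?|?] := ltP t p;
    do 2 (case: ltP => ?); apply/andP; split; lra.
exists (f \o c), L => //; split=> [x y|x Qx /=]; last by rewrite cid.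
by apply: le_trans (fL (c x, c y) _) _ => //=; rewrite ler_wpM2l.
Qed.

Lemma integrable_bounded P (phi : 'rV[R]_n -> R) (M : R) : 0 < side P ->
  measurable_fun [set: 'rV[R]_n] phi ->
  (forall x, cube_set P x -> `|phi x| <= M) ->
  mu.-integrable (cube_set P) (EFin \o phi).
Proof.
move=> P0 mphi phiM; apply: measurable_bounded_integrable.
- exact: measurable_cube_set.
- by rewrite -EFin_volume// ltry.
- by apply: measurable_funTS; exact: measurable_fun_lebesgue_rV.
- exists M; split; first exact: num_real.
  by move=> N MN x /phiM h; exact: le_trans h (ltW MN).
Qed.

Lemma integrable_lipschitz P (f : 'rV[R]_n -> R) (L : R) : 0 <= L ->
  lipschitz_with L f -> 0 < side P ->
  mu.-integrable (cube_set P) (EFin \o f).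
Proof.
move=> L0 fL P0; apply: (integrable_bounded (M := `|f (corner P)| + L * side P)) => //.
  exact: lipschitz_measurable L0 fL.
move=> x Px; rewrite -{1}(subrK (f (corner P)) (f x)) addrC.
apply: le_trans (ler_normD _ _) _; rewrite lerD2l.
apply: le_trans (fL _ _) _; rewrite ler_wpM2l//.
apply: rV_norm_le => [|i]; first exact: ltW.
by rewrite !mxE; have /andP[h1 h2] := Px i; rewrite ger0_norm ?subr_ge0// lerBlDl.
Qed.

Variables (f : 'rV[R]_n -> R) (L : R).
Hypotheses (L0 : 0 <= L) (fL : lipschitz_with L f).

Definition grad_norm x : R := Num.sqrt (\sum_i (partial f i x) ^+ 2).

Lemma partial_le_grad i x : `|partial f i x| <= grad_norm x.
Proof.
rewrite -sqrtr_sqr ler_wsqrtr// (bigD1 i)//= lerDl.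
by apply: sumr_ge0 => j _; exact: sqr_ge0.
Qed.

Lemma grad_norm_ge0 x : 0 <= grad_norm x. Proof. exact: sqrtr_ge0. Qed.

Lemma measurable_grad_norm : measurable_fun [set: 'rV[R]_n] grad_norm.
Proof.
have msqrt : measurable_fun [set: R] (@Num.sqrt R).
  by apply: continuous_measurable_fun; exact: sqrt_continuous.
apply: (measurableT_comp msqrt).
by apply: measurable_sum => i; apply: measurable_funX; exact: (measurable_partial L0 fL i).
Qed.

Lemma grad_norm_le x : grad_norm x <= Num.sqrt (n%:R * L ^+ 2).
Proof.
apply: ler_wsqrtr; rewrite mulr_natl -[n in leRHS]card_ord -sumr_const.
apply: ler_sum => i _; rewrite -real_normK ?num_real// lerXn2r ?nnegrE//.
exact: partial_le L0 fL _ _.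
Qed.

Lemma integrable_grad_norm P : 0 < side P ->
  mu.-integrable (cube_set P) (EFin \o grad_norm).
Proof.
move=> P0; apply: (integrable_bounded P0 measurable_grad_norm) => x _.
rewrite ger0_norm ?grad_norm_ge0//; exact: grad_norm_le.
Qed.

Lemma Rintegral_shift (A : set 'rV[R]_n) (v : 'rV[R]_n) (phi : 'rV[R]_n -> R) :
  measurable A -> measurable_fun [set: 'rV[R]_n] phi ->
  \int[mu]_(x in A) phi x = \int[mu]_(x in (fun x => x + v) @^-1` A) phi (x + v).
Proof.
move=> mA mphi; have mv := measurable_fun_shift v.
have mA' : measurable ((fun x => x + v) @^-1` A).
  by rewrite -[X in measurable X]setTI; exact: mv.
rewrite /Rintegral integral_lebesgue_rV//; last exact/measurable_EFinP.
rewrite integral_lebesgue_rV//; last first.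
  by apply/measurable_EFinP; exact: measurableT_comp mphi mv.
by congr fine; apply: (integral_borel_shift v mA); exact/measurable_EFinP.
Qed.

(** The first child is the translate of the second by half a side along the [i]-th axis,
    and all intermediate translates stay in [P]. *)
Lemma poincare_neighbours P e i : 0 < side P -> i \in e ->
  `|\int[mu]_(x in cube_set (bisect P e)) f x -
    \int[mu]_(x in cube_set (bisect P (e :\ i)%SET)) f x| <=
  side P / 2 * \int[mu]_(x in cube_set P) grad_norm x.
Proof.
move=> P0 ie; set P' := bisect P (e :\ i)%SET.
set t := side P / 2; set v : 'rV[R]_n := t *: delta_mx ord0 i.
have t0 : 0 < t by rewrite divr_gt0.
have mf := lipschitz_measurable L0 fL.
have vE j : v ord0 j = (j == i)%:R * t by rewrite !mxE /= mulrC.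
have -> : \int[mu]_(x in cube_set (bisect P e)) f x =
    \int[mu]_(x in cube_set P') f (x + v).
  apply: etrans (Rintegral_shift v (borel_cube_set _) mf) _.
  congr Rintegral; apply/seteqP; split => x /= xP j; have := xP j;
    rewrite !corner_bisect !side_bisect -/t mxE vE !in_setD1;
    case: (eqVneq j i) => [->|ji] /=; rewrite ?ie ?mul1r ?mul0r ?addr0// => /andP[h1 h2];
    apply/andP; split; lra.
have P'0 : 0 < side P' by [].
have iff := integrable_lipschitz L0 fL P'0.
have fvL : lipschitz_with L (fun x => f (x + v)).
  by move=> x y; apply: le_trans (fL _ _) _; rewrite opprD addrACA subrr addr0.
have ifv := integrable_lipschitz L0 fvL P'0.
have mP' := measurable_cube_set P'.
have mfv := lipschitz_measurable L0 fvL.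
have idiff : mu.-integrable (cube_set P') (EFin \o (fun x => f (x + v) - f x)).
  by apply: eq_integrable (integrableB mP' ifv iff).
rewrite -RintegralB//; apply: le_trans (le_normr_Rintegral mP' idiff) _.
have finP : (\int[mu]_(x in cube_set P) (grad_norm x)%:E)%E \is a fin_num.
  by apply: integrable_fin_num; [exact: measurable_cube_set|exact: integrable_grad_norm].
rewrite -lee_fin EFinM /Rintegral fineK; last first.
  by apply: integrable_fin_num => //; exact: integrable_abse idiff.
rewrite fineK//; have bP := borel_cube_set P; have bP' := borel_cube_set P'.
rewrite integral_lebesgue_rV//; last first.
  by apply/measurable_EFinP/measurableT_comp => //; exact: measurable_funB.
rewrite integral_lebesgue_rV//; last first.
  by apply/measurable_EFinP; exact: measurable_grad_norm.
apply: (@le_trans _ _ (t%:E * \int[nu]_(x in cube_set P) `|partial f i x|%:E)%E).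
  apply: (integral_increment L0 fL) => //.
  - by rewrite lebesgue_cube_set// ltry.
  - move=> x s xA s0 st j; rewrite !mxE /=.
    have := xA j; rewrite corner_bisect side_bisect in_setD1 -/t => h.
    have [ji|ji] := eqVneq j i; move: h; rewrite ?ji ?eqxx ?(negbTE ji) /= ?mulr1 ?mulr0 ?mul0r ?addr0.
      by move=> /andP[h1 h2]; apply/andP; split; rewrite /t in h2 st *; lra.
    by case: (j \in e) => /andP[]; rewrite ?mul1r ?mul0r => h1 h2; apply/andP; split; rewrite /t in h1 h2 t0 *; lra.
rewrite lee_pmul2l//; apply: ge0_le_integral => //.
- apply/measurable_EFinP/measurable_funTS/measurableT_comp => //.
  exact: (measurable_partial L0 fL i).
- by apply/measurable_EFinP/measurable_funTS; exact: measurable_grad_norm.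
- by move=> x _; rewrite lee_fin partial_le_grad.
Qed.

Lemma sum_dist_le (I : finType) (J : I -> R) (z B : R) (i : I) :
  (forall j, `|J j - z| <= B) ->
  `|\sum_j J j - #|I|%:R * J i| <= #|I|%:R * (2 * B).
Proof.
move=> JB.
have -> : \sum_j J j - #|I|%:R * J i = \sum_j (J j - J i).
  by rewrite sumrB sumr_const -[in RHS]mulr_natl.
apply: le_trans (ler_norm_sum _ _ _) _.
apply: (@le_trans _ _ (\sum_(j : I) 2 * B)).
  apply: ler_sum => j _; rewrite mulr2n mulrDl mul1r.
  apply: le_trans (lerD (JB j) (JB i)); rewrite (distrC (J i)).
  by apply: le_trans (ler_normD _ _); rewrite addrA subrK.
by rewrite sumr_const [leRHS]mulr_natl.
Qed.

(** The means over the children of a cube are compared by moving one coordinate at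
    a time. *)
Lemma poincare_bisect P e : 0 < side P ->
  `|average P f - average (bisect P e) f| <=
  (n * 2 ^ n)%:R * (side P * average P grad_norm).
Proof.
move=> P0; pose J e := \int[mu]_(x in cube_set (bisect P e)) f x.
set G := \int[mu]_(x in cube_set P) grad_norm x.
have G0 : 0 <= G by apply: Rintegral_ge0 => x _; exact: grad_norm_ge0.
have tG0 : 0 <= side P / 2 * G by rewrite mulr_ge0// divr_ge0 ?ltW.
have to0 k e' : #|e'| = k -> `|J e' - J finset.set0| <= k%:R * (side P / 2 * G).
  elim: k e' => [|k IH] e' ek.
    by rewrite (cards0_eq ek) subrr normr0 mul0r.
  have [i ie'] : exists i, i \in e' by apply/card_gt0P; rewrite ek.
  have := IH (e' :\ i)%SET; rewrite (cardsD1 i) ie' in ek; case: ek => ek /(_ ek) h.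
  rewrite -(natr1 k) mulrDl mul1r [leRHS]addrC.
  apply: le_trans (lerD (poincare_neighbours P0 ie') h).
  by apply: le_trans (ler_normD _ _); rewrite addrA subrK.
have ton e' : `|J e' - J finset.set0| <= n%:R * (side P / 2 * G).
  apply: le_trans (to0 _ e' erefl) _; rewrite ler_wpM2r// ler_nat.
  by rewrite -[leqRHS]card_ord max_card.
have V0 := volume_gt0 P0.
have JP : \int[mu]_(x in cube_set P) f x = \sum_e' J e'.
  by apply: Rintegral_bisect => //; exact: integrable_lipschitz L0 fL P0.
have cardE : #|{set 'I_n}| = (2 ^ n)%N.
  by rewrite -cardsT -powersetT card_powerset cardsT card_ord.
have := sum_dist_le e ton; rewrite cardE -JP => JPe.
rewrite /average volume_bisect//.
have -> : (volume P)^-1 * \int[mu]_(x in cube_set P) f x - (volume P / 2 ^+ n)^-1 * J e =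
    (volume P)^-1 * (\int[mu]_(x in cube_set P) f x - (2 ^ n)%:R * J e).
  by rewrite invfM invrK natrX mulrBr mulrA.
rewrite normrM normfV (gtr0_norm V0) -/G [leRHS]mulrA [leRHS]mulrCA.
rewrite ler_pM2l ?invr_gt0//; apply: le_trans JPe _.
by rewrite natrM le_eqVlt; apply/orP; left; apply/eqP; field.
Qed.

End lipschitz_cube.

Section gradient.
Context {R : realType} {n : nat}.
Local Notation mu := (lebesgue_rV R n).
Implicit Types (Q : cube R n) (x : 'rV[R]_n).

Lemma ae_lebesgue_rV (N : set 'rV[R]_n) : measurable N ->
  lebesgue_borel R n N = 0%E -> {ae mu, forall x, ~ N x}.
Proof.
move=> mN N0; exists N; split.
- exact: measurable_lebesgue_rV.
- by rewrite [LHS]lebesgue_rVE.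
- by move=> x /=; exact: contrapT.
Qed.

Lemma open_cube_nbhs Q x : cube_itv false true Q x -> \forall y \near x, cube_set Q y.
Proof.
move=> Qx; pose C i (y : 'rV[R]_n) :=
  corner Q ord0 i <= y ord0 i <= corner Q ord0 i + side Q.
suff : \forall y \near x, forall i, C i y by [].
apply: (@filter_forall _ _ C (nbhs x) (nbhs_filter x)) => i; rewrite /C.
have := Qx i; rewrite in_itv /= => /andP[h1 h2].
have cx := @coord_continuous _ 1 n ord0 i x.
near=> y; apply/andP; split; apply: ltW; near: y.
- exact: cvgr_gt cx _ h1.
- exact: cvgr_lt cx _ h2.
Unshelve. all: by end_near. Qed.

(** At an interior point the two functions agree nearby, and the boundary of the cube is
    a null set. *)
Lemma ae_norm_grad Q (f g : 'rV[R]_n -> R) (L : R) : 0 < side Q -> 0 <= L ->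
  lipschitz_with L g -> (forall x, cube_set Q x -> g x = f x) ->
  {ae mu, forall x, cube_set Q x -> norm_grad f x = grad_norm g x}.
Proof.
move=> Q0 L0 gL gf.
have H1 : {ae mu, forall x, ~ (cube_set Q `\` cube_itv false true Q) x}.
  apply: ae_lebesgue_rV.
    by apply: measurableD; [exact: borel_cube_set|exact: borel_cube_itv].
  by apply: lebesgue_cube_boundary => //; exact: open_cube_subset.
have H2 : {ae mu, forall x, forall i, ~ nonderivable_set g i x}.
  apply: (@filter_forall _ _ (fun i x => ~ nonderivable_set g i x) _
    (ae_filter_ringOfSetsType mu)) => i.
  apply: ae_lebesgue_rV.
    exact: measurable_nonderivable_set L0 gL.
  exact: lebesgue_nonderivable_set L0 gL i.
apply: filterS2 H1 H2; first exact: (ae_filter_ringOfSetsType mu).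
move=> x x1 x2 Qx.
have Ox : cube_itv false true Q x by apply: contrapT => Ox; exact: x1.
rewrite /norm_grad /grad_norm; congr Num.sqrt; apply: eq_bigr => i _.
rewrite /partial indicE mem_set ?mulr1; last exact: x2.
congr (_ ^+ 2); apply: near_eq_derive.
by apply: filterS (open_cube_nbhs Ox) => y /gf.
Qed.

End gradient.

(** * Means over cubes *)

Section cube_integrals.
Context {R : realType} {n : nat}.
Local Notation mu := (lebesgue_rV R n).
Local Notation nu := (lebesgue_borel R n).
Local Notation leb := (caratheodory_type (nu^*)%mu).
Implicit Types (P Q S : cube R n) (phi psi : 'rV[R]_n -> R).

Lemma integrable_cst_cube P (k : R) : 0 < side P ->
  mu.-integrable (cube_set P) (EFin \o cst k).
Proof.
move=> P0; apply: (integrable_bounded (M := `|k|)) => //.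
Qed.

Lemma measurable_powRc phi (a : R) : measurable_fun [set: leb] phi ->
  measurable_fun [set: leb] (fun x => phi x `^ a).
Proof. by move=> mphi; exact: (measurableT_comp (measurable_powR a) mphi). Qed.

Lemma integrable_le_cube P phi psi : measurable_fun [set: leb] phi ->
  (forall x, cube_set P x -> 0 <= phi x <= psi x) ->
  mu.-integrable (cube_set P) (EFin \o psi) ->
  mu.-integrable (cube_set P) (EFin \o phi).
Proof.
move=> mphi phipsi ipsi; apply: (le_integrable _ _ _ ipsi).
- exact: measurable_cube_set.
- by apply/measurable_EFinP; exact: measurable_funTS.
- move=> x Px /=; have /andP[h0 h1] := phipsi x Px.
  by rewrite lee_fin !ger0_norm// (le_trans h0).
Qed.

Lemma integrable_powR_le P phi (a b : R) : 0 < side P -> 0 <= a -> a <= b ->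
  measurable_fun [set: leb] phi -> (forall x, 0 <= phi x) ->
  mu.-integrable (cube_set P) (EFin \o (fun x => phi x `^ b)) ->
  mu.-integrable (cube_set P) (EFin \o (fun x => phi x `^ a)).
Proof.
move=> P0 a0 ab mphi phi0 iphi.
apply: (@integrable_le_cube _ _ (fun x => 1 + phi x `^ b)).
- exact: measurable_powRc.
- by move=> x _; rewrite powR_ge0 powR_le_1D.
- exact: (integrableD (measurable_cube_set P) (integrable_cst_cube 1 P0) iphi).
Qed.

Lemma Lnorm_cube P phi (a : R) : 0 < a ->
  ('N[mu]_a%:E[(EFin \o phi) \_ (cube_set P)] =
   (\int[mu]_(x in cube_set P) (`|phi x| `^ a)%:E) `^ a^-1)%E.
Proof.
move=> a0; rewrite unlock; congr poweR.
rewrite [RHS]integral_mkcond; apply: eq_integral => x _; rewrite !patchE.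
case: ifP => _ //=.
by rewrite normr0 powR0// gt_eqF.
Qed.

Lemma EFin_Rintegral P phi : mu.-integrable (cube_set P) (EFin \o phi) ->
  (\int[mu]_(x in cube_set P) phi x)%R%:E =
  (\int[mu]_(x in cube_set P) (phi x)%:E)%E.
Proof.
move=> iphi; rewrite fineK//.
by apply: integrable_fin_num; [exact: measurable_cube_set|].
Qed.

Lemma hoelder_cube P phi psi (a b : R) :
  0 < a -> 0 < b -> a^-1 + b^-1 = 1 ->
  measurable_fun [set: leb] phi -> measurable_fun [set: leb] psi ->
  (forall x, 0 <= phi x) -> (forall x, 0 <= psi x) ->
  mu.-integrable (cube_set P) (EFin \o (fun x => phi x `^ a)) ->
  mu.-integrable (cube_set P) (EFin \o (fun x => psi x `^ b)) ->
  mu.-integrable (cube_set P) (EFin \o (fun x => phi x * psi x)) /\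
  \int[mu]_(x in cube_set P) (phi x * psi x) <=
  (\int[mu]_(x in cube_set P) phi x `^ a) `^ a^-1 *
  (\int[mu]_(x in cube_set P) psi x `^ b) `^ b^-1.
Proof.
move=> a0 b0 ab mphi mpsi phi0 psi0 iphi ipsi.
have mP := measurable_cube_set P.
have mres (k : 'rV[R]_n -> R) : measurable_fun [set: leb] k ->
    measurable_fun [set: leb] (k \_ (cube_set P)).
  by move=> mk; apply/(measurable_restrictT _ mP).1; exact: measurable_funTS.
have normE (k : 'rV[R]_n -> R) (c : R) : 0 < c -> (forall x, 0 <= k x) ->
    mu.-integrable (cube_set P) (EFin \o (fun x => k x `^ c)) ->
    'N[mu]_c%:E[EFin \o (k \_ (cube_set P))]%E =
    ((\int[mu]_(x in cube_set P) k x `^ c) `^ c^-1)%:E.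
  move=> c0 k0 ik; rewrite -restrict_EFin; apply: etrans (Lnorm_cube _ _ c0) _.
  apply: etrans _ (poweR_EFin _ _); congr poweR; rewrite (EFin_Rintegral ik).
  by apply: eq_integral => x _; rewrite (ger0_norm (k0 x)).
have := hoelder mu (mres _ mphi) (mres _ mpsi) a0 b0 ab.
rewrite !normE// Lnorm1 -EFinM.
have -> : (\int[mu]_x `|(EFin \o (phi \_ (cube_set P) \* psi \_ (cube_set P))%R) x| =
    \int[mu]_(x in cube_set P) (phi x * psi x)%:E)%E.
  rewrite [RHS]integral_mkcond; apply: eq_integral => x _; rewrite /= !patchE.
  by case: ifP => _; rewrite ?mul0r ?normr0// ger0_norm// mulr_ge0.
move=> H; have iphipsi : mu.-integrable (cube_set P) (EFin \o (fun x => phi x * psi x)).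
  apply/integrableP; split.
    by apply/measurable_EFinP/measurable_funTS; exact: measurable_funM.
  apply: le_lt_trans (ltry _); apply: le_trans H.
  by under eq_integral do rewrite /= ger0_norm ?mulr_ge0//.
by split=> //; rewrite -lee_fin EFin_Rintegral.
Qed.

Lemma hoelder_average P phi psi (a b : R) : 0 < side P ->
  0 < a -> 0 < b -> a^-1 + b^-1 = 1 ->
  measurable_fun [set: leb] phi -> measurable_fun [set: leb] psi ->
  (forall x, 0 <= phi x) -> (forall x, 0 <= psi x) ->
  mu.-integrable (cube_set P) (EFin \o (fun x => phi x `^ a)) ->
  mu.-integrable (cube_set P) (EFin \o (fun x => psi x `^ b)) ->
  average P (fun x => phi x * psi x) <=
  average P (fun x => phi x `^ a) `^ a^-1 * average P (fun x => psi x `^ b) `^ b^-1.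
Proof.
move=> P0 a0 b0 ab mphi mpsi phi0 psi0 iphi ipsi.
have [_] := hoelder_cube a0 b0 ab mphi mpsi phi0 psi0 iphi ipsi.
rewrite /average; set X := \int[mu]_(x in _) (_ `^ a); set Y := \int[mu]_(x in _) (_ `^ b).
have X0 : 0 <= X by apply: Rintegral_ge0 => x _; exact: powR_ge0.
have Y0 : 0 <= Y by apply: Rintegral_ge0 => x _; exact: powR_ge0.
have V0 : 0 < (volume P)^-1 by rewrite invr_gt0 volume_gt0.
move: V0 X0 Y0; move: (volume P)^-1 X Y => V X Y V0 X0 Y0 h.
by rewrite powR_conj_mul// ?(ltW V0)// ler_pM2l.
Qed.

Lemma Rintegral_average P phi : 0 < side P ->
  \int[mu]_(x in cube_set P) phi x = volume P * average P phi.
Proof. by move=> P0; rewrite /average mulrA mulfV ?mul1r// gt_eqF// volume_gt0. Qed.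

Lemma average_ge0 P phi : 0 < side P -> (forall x, cube_set P x -> 0 <= phi x) ->
  0 <= average P phi.
Proof.
move=> P0 phi0; rewrite mulr_ge0 ?Rintegral_ge0//.
by rewrite invr_ge0 ltW// volume_gt0.
Qed.

Lemma average_cst P (k : R) : 0 < side P -> average P (cst k) = k.
Proof.
move=> P0; rewrite /average Rintegral_cst; last exact: measurable_cube_set.
by rewrite -EFin_volume//= mulrCA mulVf ?mulr1// gt_eqF// volume_gt0.
Qed.

(** Hoelder's inequality against the constant 1. *)
Lemma jensen_average P phi (m : R) : 0 < side P -> 1 < m ->
  measurable_fun [set: leb] phi -> (forall x, 0 <= phi x) ->
  mu.-integrable (cube_set P) (EFin \o (fun x => phi x `^ m)) ->
  average P phi `^ m <= average P (fun x => phi x `^ m).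
Proof.
move=> P0 m1 mphi phi0 iphi.
pose b := m / (m - 1).
have b0 : 0 < b by rewrite divr_gt0//; lra.
have m0 : 0 < m by lra.
have mb : m^-1 + b^-1 = 1.
  by rewrite /b invf_div addrC mulrBl divff ?gt_eqF// mul1r subrK.
have i1 : mu.-integrable (cube_set P) (EFin \o (fun x => cst 1 x `^ b)).
  by under eq_fun do rewrite /= powR1; exact: integrable_cst_cube.
have := @hoelder_average P phi (cst 1) m b P0 m0 b0 mb mphi _ phi0 _ iphi i1.
have -> : (fun x => phi x * cst 1 x) = phi by apply/funext => x /=; rewrite mulr1.
have -> : (fun x : 'rV[R]_n => cst (1 : R) x `^ b) = cst 1.
  by apply/funext => x /=; rewrite powR1.
rewrite average_cst// powR1 mulr1 => h.
have A0 : 0 <= average P phi by exact: average_ge0.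
have -> : average P (fun x => phi x `^ m) =
    (average P (fun x => phi x `^ m) `^ m^-1) `^ m.
  by rewrite powRVK//; apply: average_ge0 => // x _; exact: powR_ge0.
apply: ge0_ler_powR; rewrite ?nnegrE ?powR_ge0 ?(ltW m0)//; apply: h => //.
Qed.

End cube_integrals.

(** * Sums over sparse families of cubes *)

Section sparse_sums.
Context {R : realType} {n : nat}.
Local Notation mu := (lebesgue_rV R n).
Local Notation nu := (lebesgue_borel R n).
Local Notation leb := (caratheodory_type (nu^*)%mu).
Implicit Types (P S : cube R n) (phi psi : 'rV[R]_n -> R).

Lemma integrable_cube_le S (Q : cube R n) phi : 0 < side Q -> dyadic Q S ->
  mu.-integrable (cube_set Q) (EFin \o phi) ->
  mu.-integrable (cube_set S) (EFin \o phi).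
Proof.
move=> Q0 QS; apply: integrableS; [exact: measurable_cube_set..|].
exact: dyadic_cube_set.
Qed.

Variables (Q : cube R n) (F : 'rV[R]_n -> R).
Hypotheses (Q0 : 0 < side Q)
  (F0 : forall x, 0 <= F x) (iF : mu.-integrable (cube_set Q) (EFin \o F)).
Local Notation sparse N := (stopping (@bisect R n) (average^~ F) N 0 Q).

(** The embedding theorem for the integrals of [phi] and [phi^m], which Jensen's
    inequality relates as required. *)
Lemma carleson_average phi (m : R) N : 1 < m ->
  measurable_fun [set: leb] phi -> (forall x, 0 <= phi x) ->
  mu.-integrable (cube_set Q) (EFin \o (fun x => phi x `^ m)) ->
  \sum_(S <- sparse N) volume S * average S phi `^ m <=
  carleson_const m * \int[mu]_(x in cube_set Q) phi x `^ m.
Proof.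
move=> m1 mphi phi0 iphi.
have iphi1 : mu.-integrable (cube_set Q) (EFin \o phi).
  have := integrable_powR_le Q0 ler01 (ltW m1) mphi phi0 iphi.
  by under eq_fun do rewrite powRr1//.
pose ok P := dyadic Q P.
have okc P e : ok P -> ok (bisect P e) by exact: dyadic_bisect.
have side0 P : ok P -> 0 < side P by move=> QP; have [] := dyadic_side QP Q0.
have vol0 P : ok P -> 0 < volume P by move=> /side0; exact: volume_gt0.
have addi psi : mu.-integrable (cube_set Q) (EFin \o psi) ->
    additive_on_tree (@bisect R n) ok (fun P => \int[mu]_(x in cube_set P) psi x).
  by move=> ipsi P QP; apply: Rintegral_bisect; [exact: side0|exact: integrable_cube_le Q0 QP ipsi].
have vol_add : additive_on_tree (@bisect R n) ok volume.
  move=> P QP; have P0 := side0 P QP.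
  have -> : volume P = \int[mu]_(x in cube_set P) cst 1 x.
    by rewrite Rintegral_average// average_cst// mulr1.
  rewrite (addi _ (integrable_cst_cube 1 Q0) P QP); apply: eq_bigr => e _.
  have e0 := side0 _ (okc P e QP).
  by rewrite Rintegral_average// average_cst// mulr1.
have := @carleson_embedding R (cube R n) _ (@bisect R n) (average^~ F) ok okc
  volume (fun P => \int[mu]_(x in cube_set P) F x) vol0 _ _ vol_add (addi _ iF)
  (fun P => \int[mu]_(x in cube_set P) phi x)
  (fun P => \int[mu]_(x in cube_set P) phi x `^ m) m m1 _ _ (addi _ iphi1) (addi _ iphi)
  N 0 Q (lexx 0) (dyadic_refl Q).
have int0 P psi : (forall x, 0 <= psi x) -> 0 <= \int[mu]_(x in cube_set P) psi x.
  by move=> psi0; apply: Rintegral_ge0.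
have E P : ok P -> (\int[mu]_(x in cube_set P) phi x) `^ m * volume P `^ (1 - m) =
    volume P * average P phi `^ m.
  by move=> QP; apply: powR_mean; [exact: vol0|exact: int0].
have -> : \sum_(S <- sparse N) (\int[mu]_(x in cube_set S) phi x) `^ m *
    volume S `^ (1 - m) = \sum_(S <- sparse N) volume S * average S phi `^ m.
  by rewrite !big_seq; apply: eq_bigr => S /stopping_dyadic/E.
apply.
- by move=> P QP; apply: average_ge0 => //; exact: side0.
- by move=> P QP; rewrite Rintegral_average ?side0// mulrC.
- by move=> P QP; exact: int0.
- move=> P QP; rewrite E// Rintegral_average ?side0//.
  rewrite ler_pM2l ?vol0//; apply: jensen_average => //; first exact: side0.
  exact: integrable_cube_le Q0 QP iphi.
Qed.

(** The form of the embedding in which the mean is an [L^k] mean, [k < m]. *)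
Lemma carleson_power_mean phi (k m : R) N : 0 < k -> k < m ->
  measurable_fun [set: leb] phi -> (forall x, 0 <= phi x) ->
  mu.-integrable (cube_set Q) (EFin \o (fun x => phi x `^ m)) ->
  \sum_(S <- sparse N)
    (volume S `^ m^-1 * average S (fun x => phi x `^ k) `^ k^-1) `^ m <=
  carleson_const (m / k) * \int[mu]_(x in cube_set Q) phi x `^ m.
Proof.
move=> k0 km mphi phi0 iphi; have m0 : 0 < m := lt_trans k0 km.
have m1 : 1 < m / k by rewrite ltr_pdivlMr ?mul1r.
have E : (fun x => (phi x `^ k) `^ (m / k)) = (fun x => phi x `^ m).
  by apply/funext => x; rewrite -(powRrM (phi x)) (mulrC k) divfK ?gt_eqF.
have := @carleson_average (fun x => phi x `^ k) (m / k) N m1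
  (measurable_powRc k mphi) (fun x => powR_ge0 _ _).
rewrite E => /(_ iphi); apply: le_trans; rewrite !big_seq; apply: ler_sum => S.
move=> /stopping_dyadic QS; have [S0 _] := dyadic_side QS Q0.
have a0 : 0 <= average S (fun x => phi x `^ k).
  by apply: average_ge0 => // x _; exact: powR_ge0.
move: (average S _) a0 => a a0; move: (volume S) (volume_gt0 S0) => V V0.
rewrite (powRM m (powR_ge0 V m^-1) (powR_ge0 a k^-1)) (powRVK (ltW V0) m0).
by rewrite -(powRrM a) [k^-1 * m]mulrC.
Qed.

Lemma Rintegral_indic_cube P psi : dyadic Q P ->
  \int[mu]_(x in cube_set Q) ((x \in cube_set P)%:R * psi x) =
  \int[mu]_(x in cube_set P) psi x.
Proof.
move=> QP; rewrite /Rintegral; congr fine.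
rewrite [LHS]integral_mkcond [RHS]integral_mkcond; apply: eq_integral => x _.
rewrite !patchE; case: ifP => Qx; case: ifP => Px; rewrite ?mul1r ?mul0r//.
by move: Px Qx; rewrite !inE => /(dyadic_cube_set QP Q0) Qx /negP; rewrite inE.
Qed.

Definition cube_sum (s : seq (cube R n)) (a : cube R n -> R) x : R :=
  \sum_(S <- s) a S * (x \in cube_set S)%:R.

Lemma cube_sum_ge0 s a x : (forall S, S \in s -> 0 <= a S) -> 0 <= cube_sum s a x.
Proof.
move=> a0; rewrite /cube_sum big_seq; apply: sumr_ge0 => S Ss.
by rewrite mulr_ge0 ?a0.
Qed.

Lemma measurable_cube_sum s a : measurable_fun [set: leb] (cube_sum s a).
Proof.
have mS S : measurable_fun [set: leb] (fun x : leb => (x \in cube_set S)%:R : R).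
  by apply: (@measurable_indic _ leb R [set: leb] (cube_set S)); exact: measurable_cube_set.
have maS S : measurable_fun [set: leb] (fun x : leb => a S * (x \in cube_set S)%:R).
  by apply: measurable_funM; [exact: measurable_cst|exact: mS].
exact: (measurable_sum _ maS).
Qed.

Lemma cube_sum_le s a x : cube_sum s a x <= \sum_(S <- s) `|a S|.
Proof.
apply: ler_sum => S _; case: (x \in _); first by rewrite mulr1 ler_norm.
by rewrite mulr0.
Qed.

Lemma Rintegral_cube_sum s a psi :
  (forall S, S \in s -> dyadic Q S) ->
  mu.-integrable (cube_set Q) (EFin \o psi) ->
  mu.-integrable (cube_set Q) (EFin \o (fun x => cube_sum s a x * psi x)) /\
  \int[mu]_(x in cube_set Q) (cube_sum s a x * psi x) =
  \sum_(S <- s) a S * \int[mu]_(x in cube_set S) psi x.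
Proof.
move=> QS ipsi; have mQ := measurable_cube_set Q.
elim: s QS => [|S s IH] QS.
  rewrite big_nil; have -> : (fun x => cube_sum [::] a x * psi x) = cst 0.
    by apply/funext => x; rewrite /cube_sum big_nil mul0r.
  by split; [exact: integrable_cst_cube|rewrite Rintegral_cst// mul0r].
have {IH}[i1 IH] := IH (fun S' S's => QS S' (mem_behead (s := S :: s) S's)).
have QS1 := QS S (mem_head _ _).
have i2 : mu.-integrable (cube_set Q) (EFin \o (fun x => (x \in cube_set S)%:R * psi x)).
  have -> : EFin \o (fun x => (x \in cube_set S)%:R * psi x) = (EFin \o psi) \_ (cube_set S).
    apply/funext => x; rewrite patchE /=; case: ifP => _; rewrite ?mul1r ?mul0r//.
  apply: (integrableS measurableT mQ (@subsetT _ _)).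
  apply/(integrable_mkcond _ (measurable_cube_set S)).
  exact: integrable_cube_le Q0 QS1 ipsi.
have i3 : mu.-integrable (cube_set Q) (EFin \o (fun x => a S * ((x \in cube_set S)%:R * psi x))).
  by have := integrableZl mQ (a S) i2.
have E : (fun x => cube_sum (S :: s) a x * psi x) =
    (fun x => a S * ((x \in cube_set S)%:R * psi x) + cube_sum s a x * psi x).
  by apply/funext => x; rewrite /cube_sum big_cons mulrDl mulrA.
rewrite E; split; first exact: (integrableD mQ i3 i1).
by rewrite RintegralD// RintegralZl// IH Rintegral_indic_cube// big_cons.
Qed.

End sparse_sums.

(** * The weighted bound for the sparse operator *)

Section exponents.
Context {R : realType}.

Lemma powR_scale (V p q : R) : 0 < V ->
  V `^ p^-1 / V `^ (p^-1 - q^-1) = V `^ q^-1.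
Proof.
move=> V0; rewrite -powRN -(powRD (x := V)) ?(gt_eqF V0) ?implybT//.
by congr (_ `^ _); ring.
Qed.

(** The exponents of the volume cancel: [1/p - (1/p - 1/q) = 1/q]. *)
Lemma sparse_term_le1 (p q l u V W G I : R) : 0 < q -> 0 <= l -> 0 <= u -> 0 < V ->
  0 <= W -> 0 <= G -> 0 <= I -> u <= W * G ->
  (l * u) `^ q * (V * I) <=
  ((l / V `^ (p^-1 - q^-1) * W * I `^ q^-1) * (V `^ p^-1 * G)) `^ q.
Proof.
move=> q0 l0 u0 V0 W0 G0 I0 uWG; have V0' := ltW V0.
have -> : (l / V `^ (p^-1 - q^-1) * W * I `^ q^-1) * (V `^ p^-1 * G) =
    l * (W * G) * (V `^ p^-1 / V `^ (p^-1 - q^-1) * I `^ q^-1) by ring.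
rewrite (powR_scale p q V0) -(powRM q^-1 V0' I0).
have lu0 : 0 <= l * u by rewrite mulr_ge0.
have lWG : 0 <= l * (W * G) by rewrite !mulr_ge0.
rewrite (powRM q lWG (powR_ge0 _ _)) (powRVK (mulr_ge0 V0' I0) q0).
apply: ler_wpM2r; first by rewrite mulr_ge0.
apply: ge0_ler_powR; rewrite ?nnegrE ?(ltW q0)//.
by rewrite ler_wpM2l.
Qed.

(** The exponents of the volume add up to 1: [1/p - (1/p - 1/q) + 1/q' = 1]. *)
Lemma sparse_term_gt1 (p q q' l u V W G X H : R) : q^-1 + q'^-1 = 1 ->
  0 <= l -> 0 < V -> 0 <= X -> 0 <= H -> u <= W * G ->
  l * u * (V * (X * H)) <=
  (l / V `^ (p^-1 - q^-1) * W * X) * (V `^ p^-1 * G) * (V `^ q'^-1 * H).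
Proof.
move=> qq' l0 V0 X0 H0 uWG; have V0' := ltW V0.
have -> : (l / V `^ (p^-1 - q^-1) * W * X) * (V `^ p^-1 * G) * (V `^ q'^-1 * H) =
    l * (W * G) * (V `^ p^-1 / V `^ (p^-1 - q^-1) * V `^ q'^-1 * (X * H)) by ring.
rewrite (powR_scale p q V0) -(powRD (x := V)) ?(gt_eqF V0) ?implybT//.
rewrite qq' (powRr1 V0'); apply: ler_wpM2r; first by rewrite !mulr_ge0.
by rewrite ler_wpM2l.
Qed.

(** Duality bounds [X] by a power of [X] itself with exponent less than 1, which
    can be absorbed because [X] is finite. *)
Lemma powR_absorb (q X Y c : R) : 1 < q -> 0 <= X -> 0 <= Y -> 0 < c ->
  X <= Y `^ q^-1 * (c * X) `^ (q / (q - 1))^-1 -> X <= c `^ (q - 1) * Y.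
Proof.
move=> q1 X0 Y0 c0 h; have q0 : 0 < q by lra.
have [->|Xn0] := eqVneq X 0; first by rewrite mulr_ge0 ?powR_ge0.
have Xp : 0 < X by rewrite lt_def Xn0.
have cX0 : 0 <= c * X by rewrite mulr_ge0// ltW.
have : X `^ q <= (Y `^ q^-1 * (c * X) `^ (q / (q - 1))^-1) `^ q.
  by apply: ge0_ler_powR; rewrite ?nnegrE ?mulr_ge0 ?powR_ge0 ?(ltW q0).
rewrite (powRM q (powR_ge0 _ _) (powR_ge0 _ _)) (powRVK Y0 q0).
rewrite -(powRrM (c * X)) invf_div divfK ?gt_eqF//.
rewrite (powRM (q - 1) (ltW c0) X0) mulrA.
have -> : X `^ q = X * X `^ (q - 1).
  rewrite -{2}(powRr1 X0) -(powRD (x := X)) ?Xn0 ?implybT//.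
  by congr (_ `^ _); ring.
by rewrite ler_pM2r ?powR_gt0// mulrC.
Qed.

(** Since [r > 1], the exponent [p' r] of [w^-1] exceeds [p'], hence its conjugate
    is less than [p]. *)
Lemma weight_exponents (p r : R) : 1 < p -> 1 < r ->
  let sigma := p / (p - 1) * r in let kappa := sigma / (sigma - 1) in
  [/\ 1 < sigma, 0 < kappa, kappa < p & sigma^-1 + kappa^-1 = 1].
Proof.
move=> p1 r1 sigma kappa.
have pp : 0 < p / (p - 1) by rewrite divr_gt0//; lra.
have pp1 : 1 < p / (p - 1) by rewrite ltr_pdivlMr ?mul1r; lra.
have h : p / (p - 1) < sigma by rewrite /sigma ltr_pMr.
move: sigma h @kappa => S h; have S1 : 1 < S by lra.
split=> //; first by rewrite divr_gt0//; lra.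
- move: h; rewrite ltr_pdivrMr; last by lra.
  by rewrite ltr_pdivrMr; [nra|lra].
- by rewrite invf_div addrC mulrBl divff ?mul1r ?subrK// gt_eqF//; lra.
Qed.

(** Likewise [r > 1] makes the conjugate [t] of [q r] less than the conjugate [q'] of
    [q], which leaves room for the embedding theorem in [L^(q'/t)]. *)
Lemma dual_exponents (q r : R) : 1 < q -> 1 < r ->
  let t := q * r / (q * r - 1) in let q' := q / (q - 1) in
  [/\ 0 < t, t < q', (q * r)^-1 + t^-1 = 1, q^-1 + q'^-1 = 1 & (q - 1) * q' = q].
Proof.
move=> q1 r1 t q'.
have S1 : 1 < q * r by nra.
split.
- by rewrite /t divr_gt0//; lra.
- rewrite /t /q' ltr_pdivrMr; last by lra.
  rewrite mulrAC ltr_pdivlMr; last by lra.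
  nra.
- by rewrite invf_div addrC mulrBl divff ?mul1r ?subrK// gt_eqF//; lra.
- by rewrite invf_div addrC mulrBl divff ?mul1r ?subrK// gt_eqF//; lra.
- by rewrite /q' mulrC divfK// gt_eqF//; lra.
Qed.

End exponents.

Section weighted_sparse.
Context {R : realType} {n : nat}.
Local Notation mu := (lebesgue_rV R n).
Local Notation nu := (lebesgue_borel R n).
Local Notation leb := (caratheodory_type (nu^*)%mu).
Variables (p q r s rho : R) (Q : cube R n) (F w v : 'rV[R]_n -> R).
Hypotheses (p_gt1 : 1 < p) (r_gt1 : 1 < r) (q_gt0 : 0 < q) (rho_gt0 : 0 < rho)
  (s_ge1 : 1 <= s)
  (pq_rho : q^-1 = p^-1 + rho^-1).
Hypotheses (Q0 : 0 < side Q) (mF : measurable_fun [set: leb] F)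
  (F0 : forall x, 0 <= F x) (iF : mu.-integrable (cube_set Q) (EFin \o F)).
Local Notation sigma := (p / (p - 1) * r).
Local Notation kappa := (sigma / (sigma - 1)).
Hypotheses (mw : measurable_fun [set: leb] w) (mv : measurable_fun [set: leb] v)
  (w_gt0 : forall x, 0 < w x) (v_gt0 : forall x, 0 < v x)
  (iw : mu.-integrable (cube_set Q) (EFin \o (fun x => w x `^ (- sigma))))
  (iv : mu.-integrable (cube_set Q) (EFin \o (fun x => v x `^ (q * s))))
  (ig : mu.-integrable (cube_set Q) (EFin \o (fun x => (w x * F x) `^ p))).
Local Notation sparse N := (stopping (@bisect R n) (average^~ F) N 0 Q).

(** The bracket in the definition of the weight constant. *)
Definition weight_term S : R :=
  side S / volume S `^ (p^-1 - q^-1)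
  * average S (fun x => w x `^ (- (p / (p - 1) * r))) `^ (p / (p - 1) * r)^-1
  * average S (fun x => v x `^ (q * s)) `^ (q * s)^-1.

(** Normalized so that the [p]-th power is the term of the Carleson embedding with
    exponents [kappa < p]. *)
Definition mean_term S : R :=
  volume S `^ p^-1 * average S (fun x => (w x * F x) `^ kappa) `^ kappa^-1.

Local Notation g := (fun x : 'rV[R]_n => w x * F x).

Let mg : measurable_fun [set: leb] g. Proof. exact: measurable_funM. Qed.
Let g0 x : 0 <= w x * F x. Proof. by rewrite mulr_ge0// ltW. Qed.

Let p0 : 0 < p. Proof. exact: lt_trans ltr01 p_gt1. Qed.

Let sigma_gt1 : 1 < sigma. Proof. by have [] := weight_exponents p_gt1 r_gt1. Qed.

Let kappa_gt0 : 0 < kappa. Proof. by have [] := weight_exponents p_gt1 r_gt1. Qed.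

Let kappa_lt : kappa < p. Proof. by have [] := weight_exponents p_gt1 r_gt1. Qed.

Let sigma_kappa : sigma^-1 + kappa^-1 = 1.
Proof. by have [] := weight_exponents p_gt1 r_gt1. Qed.

Let side_dyadic S : dyadic Q S -> 0 < side S.
Proof. by move=> QS; have [] := dyadic_side QS Q0. Qed.

Let igk : mu.-integrable (cube_set Q) (EFin \o (fun x => (w x * F x) `^ kappa)).
Proof. exact: integrable_powR_le (ltW kappa_gt0) (ltW kappa_lt) mg g0 ig. Qed.

(** Hoelder's inequality for [F = w^-1 (w F)]. *)
Lemma average_le_weighted S : dyadic Q S ->
  average S F <=
  average S (fun x => w x `^ (- sigma)) `^ sigma^-1 *
  average S (fun x => (w x * F x) `^ kappa) `^ kappa^-1.
Proof.
move=> QS; have S0 := side_dyadic QS.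
have s0 : 0 < sigma by exact: lt_trans ltr01 sigma_gt1.
have E1 : (fun x => (w x)^-1 * g x) = F.
  by apply/funext => x; rewrite mulrA mulVf ?mul1r// gt_eqF.
have E2 : (fun x => (w x)^-1 `^ sigma) = (fun x => w x `^ (- sigma)).
  apply/funext => x.
  by rewrite -(powR_inv1 (ltW (w_gt0 x))) -(powRrM (w x)) mulN1r.
have := @hoelder_average R n S (fun x => (w x)^-1) g sigma kappa S0 s0 kappa_gt0
  sigma_kappa _ mg _ g0.
rewrite E1 E2; apply.
- by have := measurable_powRc (-1) mw; under eq_fun do rewrite powR_inv1 ?(ltW (w_gt0 _))//.
- by move=> x; rewrite invr_ge0 ltW.
- exact: integrable_cube_le Q0 QS iw.
- exact: integrable_cube_le Q0 QS igk.
Qed.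

Let mean_term_ge0 S : 0 <= mean_term S.
Proof. by rewrite mulr_ge0 ?powR_ge0. Qed.

Lemma weight_term_ge0 S : dyadic Q S -> 0 <= weight_term S.
Proof.
move=> QS; rewrite /weight_term; apply: mulr_ge0; last exact: powR_ge0.
apply: mulr_ge0; last exact: powR_ge0.
by rewrite divr_ge0 ?powR_ge0// ltW// side_dyadic.
Qed.

Lemma sum_mean_term N :
  \sum_(S <- sparse N) mean_term S `^ p <=
  carleson_const (p / kappa) * \int[mu]_(x in cube_set Q) (w x * F x) `^ p.
Proof. exact: (carleson_power_mean Q0 F0 iF N kappa_gt0 kappa_lt mg g0 ig). Qed.

Definition sparse_sum N := \sum_(S <- sparse N) (weight_term S * mean_term S) `^ q.

Lemma sparse_sum_le N :
  sparse_sum N <=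
  (\sum_(S <- sparse N) weight_term S `^ rho) `^ (q / rho) *
  (carleson_const (p / kappa) * \int[mu]_(x in cube_set Q) (w x * F x) `^ p) `^ (q / p).
Proof.
rewrite /sparse_sum.
pose A S := `|weight_term S|.
have AE S : S \in sparse N -> weight_term S = A S.
  by move=> /stopping_dyadic QS; rewrite /A ger0_norm ?weight_term_ge0.
rewrite (eq_big_seq (fun S => (A S * mean_term S) `^ q)); last by move=> S /AE ->.
rewrite [in leRHS](eq_big_seq (fun S => A S `^ rho)); last by move=> S /AE ->.
apply: le_trans (@hoelder_sum_powR R _ (sparse N) A mean_term q rho p
  (fun S => normr_ge0 _) mean_term_ge0 q_gt0 rho_gt0 p0 _) _.
- by rewrite pq_rho addrC.
- apply: ler_wpM2l; first exact: powR_ge0.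
  apply: ge0_ler_powR (sum_mean_term N).
  + by rewrite divr_ge0 ?ltW.
  + by rewrite nnegrE sumr_ge0// => S _; exact: powR_ge0.
  + rewrite nnegrE; apply: le_trans (sum_mean_term N).
    by rewrite sumr_ge0// => S _; exact: powR_ge0.
Qed.

(** The sparse operator that dominates the oscillation, see [oscillation_le]. *)
Definition sparse_fun N : 'rV[R]_n -> R :=
  cube_sum (sparse N) (fun S => side S * average S F).

Let sparse_side N S : S \in sparse N -> 0 < side S.
Proof. by move=> /stopping_dyadic/side_dyadic. Qed.

Let average_F_ge0 N S : S \in sparse N -> 0 <= average S F.
Proof. by move=> /sparse_side S0; exact: average_ge0. Qed.

Let coef_ge0 N S : S \in sparse N -> 0 <= side S * average S F.
Proof. by move=> Ss; rewrite mulr_ge0 ?(average_F_ge0 Ss)// ltW// (sparse_side Ss). Qed.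

Lemma sparse_fun_ge0 N x : 0 <= sparse_fun N x.
Proof. by apply: cube_sum_ge0 => S; exact: coef_ge0. Qed.

Let vs N x := v x * sparse_fun N x.

Let mvs N : measurable_fun [set: leb] (vs N).
Proof. by apply: measurable_funM => //; exact: measurable_cube_sum. Qed.

Let vs_ge0 N x : 0 <= vs N x.
Proof. by rewrite mulr_ge0 ?sparse_fun_ge0// ltW. Qed.

Lemma integrable_weight_powR :
  mu.-integrable (cube_set Q) (EFin \o (fun x => v x `^ q)).
Proof.
apply: (integrable_powR_le Q0 (ltW q_gt0) _ mv _ iv); last by move=> x; exact: ltW.
by rewrite ler_pMr.
Qed.

Lemma integrable_sparse_fun N :
  mu.-integrable (cube_set Q) (EFin \o (fun x => (v x * sparse_fun N x) `^ q)).
Proof.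
pose M := \sum_(S <- sparse N) `|side S * average S F|.
have M0 : 0 <= M by apply: sumr_ge0.
apply: (@integrable_le_cube _ _ Q _ (fun x => M `^ q * v x `^ q)).
- exact: (measurable_powRc q (mvs N)).
- move=> x _; rewrite powR_ge0 /= -(powRM q M0 (ltW (v_gt0 x))).
  apply: ge0_ler_powR; rewrite ?nnegrE ?(ltW q_gt0)//.
  + exact: vs_ge0.
  + by rewrite mulr_ge0// ltW.
  + by rewrite mulrC ler_wpM2r ?(ltW (v_gt0 x))//; exact: cube_sum_le.
- exact: (integrableZl (measurable_cube_set Q) (M `^ q) integrable_weight_powR).
Qed.

(** The [q]-th power of the sum is at most the sum of the [q]-th powers. *)
Lemma sparse_bound_le1 N : q <= 1 -> s = 1 ->
  \int[mu]_(x in cube_set Q) (v x * sparse_fun N x) `^ q <= sparse_sum N.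
Proof.
move=> q_le1 s1.
pose a S := (`|side S| * `|average S F|) `^ q.
have aE S : S \in sparse N -> a S = (side S * average S F) `^ q.
  move=> Ss; rewrite /a ger0_norm ?(ltW (sparse_side Ss))//.
  by rewrite ger0_norm ?(average_F_ge0 Ss).
have ptw x : (v x * sparse_fun N x) `^ q <= cube_sum (sparse N) a x * v x `^ q.
  rewrite (powRM q (ltW (v_gt0 x)) (sparse_fun_ge0 N x)) mulrC.
  rewrite ler_wpM2r ?powR_ge0// /sparse_fun /cube_sum.
  rewrite (eq_big_seq (fun S => `|side S| * `|average S F| * (x \in cube_set S)%:R)).
    apply: le_trans (le_powR_sum _ q_gt0 q_le1 _) _.
      by move=> S; rewrite !mulr_ge0.
    apply: ler_sum => S _; case: (x \in _); rewrite ?mulr1 ?mulr0//.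
    by rewrite powR0 ?gt_eqF.
  move=> S Ss; rewrite ger0_norm ?(ltW (sparse_side Ss))//.
  by rewrite ger0_norm ?(average_F_ge0 Ss).
have sQ S : S \in sparse N -> dyadic Q S by exact: stopping_dyadic.
have [isum E] := Rintegral_cube_sum Q0 a sQ integrable_weight_powR.
apply: le_trans (le_Rintegral (measurable_cube_set Q) (integrable_sparse_fun N) isum _) _.
  by move=> x _; exact: ptw.
rewrite E /sparse_sum !big_seq; apply: ler_sum => S Ss; rewrite (aE _ Ss).
have S0 := sparse_side Ss; rewrite (Rintegral_average _ S0) /weight_term /mean_term s1 mulr1.
apply: sparse_term_le1; rewrite ?(ltW S0) ?(average_F_ge0 Ss) ?powR_ge0//.
- exact: volume_gt0.
- by apply: average_ge0 => // x _; exact: powR_ge0.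
- exact: (average_le_weighted (sQ _ Ss)).
Qed.

Local Notation q' := (q / (q - 1)).

(** With [h = (v S)^(q-1)], where [S] is the sparse operator, the left-hand side [X] is
    the integral of [v S h]. Hoelder's inequality with exponents [q r] and [t] on each
    cube and then [q] and [q'] on the sum bounds it by [(sparse_sum N)^(1/q)] times
    [(C X)^(1/q')]. *)
Lemma sparse_bound_gt1 N : 1 < q -> s = r ->
  \int[mu]_(x in cube_set Q) (v x * sparse_fun N x) `^ q <=
  carleson_const (q' / (q * r / (q * r - 1))) `^ (q - 1) * sparse_sum N.
Proof.
move=> q_gt1 sr; have sQ S : S \in sparse N -> dyadic Q S by exact: stopping_dyadic.
have [t0 tq' qrt qq' q'E] := dual_exponents q_gt1 r_gt1.
set t := q * r / (q * r - 1) in t0 tq' qrt *.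
set X := \int[mu]_(x in _) _.
pose h x := vs N x `^ (q - 1).
have mh : measurable_fun [set: leb] h by exact: (measurable_powRc (q - 1) (mvs N)).
have h0 x : 0 <= h x by exact: powR_ge0.
have v0 x : 0 <= v x by exact: ltW.
have hE : (fun x => h x `^ q') = (fun x => (v x * sparse_fun N x) `^ q).
  by apply/funext => x; rewrite -(powRrM (vs N x)) q'E.
have ih : mu.-integrable (cube_set Q) (EFin \o (fun x => h x `^ q')).
  by rewrite hE; exact: integrable_sparse_fun.
have q'0 : 0 < q' := lt_trans t0 tq'.
have iht := integrable_powR_le Q0 (ltW t0) (ltW tq') mh h0 ih.
have [ivh _] := hoelder_cube q_gt0 q'0 qq' mv mh v0 h0 integrable_weight_powR ih.
have XE : X = \int[mu]_(x in cube_set Q) (sparse_fun N x * (v x * h x)).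
  rewrite /X; congr Rintegral; apply/funext => x; rewrite mulrA [_ * v x]mulrC.
  rewrite /h -/(vs N x); have y0 := vs_ge0 N x; move: (vs N x) y0 => y y0.
  have [->|yn0] := eqVneq y 0; first by rewrite powR0 ?mul0r ?gt_eqF.
  rewrite -{2}(powRr1 y0) -(powRD (x := y)) ?yn0 ?implybT//.
  by congr (_ `^ _); ring.
have [_ E] := Rintegral_cube_sum Q0 (fun S => side S * average S F) sQ ivh.
pose d S := volume S `^ q'^-1 * average S (fun x => h x `^ t) `^ t^-1.
pose ab S := `|weight_term S * mean_term S|.
have abE S : S \in sparse N -> weight_term S * mean_term S = ab S.
  move=> Ss; apply/esym/ger0_norm/mulr_ge0; last exact: mean_term_ge0.
  exact: weight_term_ge0 (sQ _ Ss).
have d0 S : 0 <= d S by rewrite mulr_ge0 ?powR_ge0.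
have X0 : 0 <= X by apply: Rintegral_ge0 => x _; exact: powR_ge0.
have Y0 : 0 <= sparse_sum N by apply: sumr_ge0 => S _; exact: powR_ge0.
have c0 : 0 < carleson_const (q' / t).
  by apply: carleson_const_gt0; rewrite ltr_pdivlMr ?mul1r.
have ivr : mu.-integrable (cube_set Q) (EFin \o (fun x => v x `^ (q * r))).
  by have := iv; rewrite sr.
apply: (powR_absorb q_gt1 X0 Y0 c0).
rewrite {1}XE E.
apply: (@le_trans _ _ (\sum_(S <- sparse N) ab S * d S)).
  rewrite !big_seq; apply: ler_sum => S Ss; rewrite -abE//.
  have S0 := sparse_side Ss; rewrite (Rintegral_average _ S0) /weight_term /mean_term sr.
  have QS := sQ _ Ss.
  have key := hoelder_average S0 (mulr_gt0 q_gt0 (lt_trans ltr01 r_gt1)) t0 qrt mv mh v0 h0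
    (integrable_cube_le Q0 QS ivr) (integrable_cube_le Q0 QS iht).
  have su0 := coef_ge0 Ss; have V0 := volume_gt0 S0.
  apply: le_trans (ler_wpM2l su0 (ler_wpM2l (ltW V0) key)) _.
  apply: sparse_term_gt1 qq' (ltW S0) V0 _ _ (average_le_weighted QS).
    exact: powR_ge0.
  exact: powR_ge0.
apply: le_trans (hoelder_sum _ (fun S => normr_ge0 _) d0 q_gt0 q'0 qq') _.
apply: ler_pM; [exact: powR_ge0|exact: powR_ge0| |].
  by rewrite /sparse_sum (eq_big_seq _ (fun S Ss => congr1 (fun z => z `^ q) (abE S Ss))).
apply: ge0_ler_powR; rewrite ?nnegrE ?invr_ge0 ?(ltW q'0)//.
- by apply: sumr_ge0 => S _; exact: powR_ge0.
- exact: mulr_ge0 (ltW c0) X0.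
have := carleson_power_mean Q0 F0 iF N t0 tq' mh h0 ih.
by rewrite hE.
Qed.

End weighted_sparse.

(** * From oscillation to the sparse operator *)

Section oscillation.
Context {R : realType} {n : nat}.
Local Notation mu := (lebesgue_rV R n).
Local Notation nu := (lebesgue_borel R n).
Local Notation leb := (caratheodory_type (nu^*)%mu).

Variables (g : 'rV[R]_n -> R) (L : R).
Hypotheses (L0 : 0 <= L) (gL : lipschitz_with L g).

Lemma average_dist P x : 0 < side P -> cube_set P x ->
  `|g x - average P g| <= L * side P.
Proof.
move=> P0 Px; have mP := measurable_cube_set P.
have ig := integrable_lipschitz L0 gL P0.
have V0 : 0 <= (volume P)^-1 by rewrite invr_ge0 ltW// volume_gt0.
have dist y : cube_set P y -> `|g x - g y| <= L * side P.
  move=> Py; apply: le_trans (gL _ _) _; rewrite ler_wpM2l//.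
  apply: rV_norm_le => [|i]; first exact: ltW.
  have := Px i; have := Py i; rewrite !mxE.
  by move=> /andP[? ?] /andP[? ?]; rewrite ler_norml; apply/andP; split; lra.
have lo : average P (cst (g x - L * side P)) <= average P g.
  rewrite ler_wpM2l//; apply: le_Rintegral => //; first exact: integrable_cst_cube.
  by move=> y /dist; rewrite ler_norml => /andP[_]; rewrite /cst lerBlDr lerBlDl addrC.
have hi : average P g <= average P (cst (g x + L * side P)).
  rewrite ler_wpM2l//; apply: le_Rintegral => //; first exact: integrable_cst_cube.
  by move=> y /dist; rewrite ler_norml => /andP[? _]; rewrite /cst; lra.
move: lo hi; rewrite !average_cst// => lo hi.
by rewrite ler_norml; apply/andP; split; lra.
Qed.

(** Telescoping along the cubes that contain [x], with the sum over the selected ones. *)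
Lemma oscillation_le Q N x : 0 < side Q -> cube_set Q x ->
  `|g x - average Q g| <=
  L * (side Q / 2 ^+ N) + 4 * (n * 2 ^ n)%:R * sparse_fun Q (grad_norm g) N x.
Proof.
move=> Q0 Qx; pose ok P := dyadic Q P.
have side0 P : ok P -> 0 < side P by move=> QP; have [] := dyadic_side QP Q0.
have := @stopping_chain R (cube R n) _ (@bisect R n) (average^~ (grad_norm g)) ok
  (fun P e => @dyadic_bisect _ _ _ P e) side (fun P => `|g x - average P g|)
  (fun P => x \in cube_set P) (n * 2 ^ n)%:R L (ler0n _ _)
  _ _ _ _ _ _ N 0 Q (lexx 0) (dyadic_refl Q).
rewrite mul0r addr0; apply.
- by move=> P /side0/ltW.
- by move=> P /side0 P0; apply: average_ge0 => // y _; exact: grad_norm_ge0.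
- by [].
- move=> P _; rewrite inE => /cube_set_cover[e xe]; exists e; exact/mem_set.
- by move=> P /side0 P0; rewrite inE; exact: average_dist.
- move=> P e /side0 P0 _ _.
  have := poincare_bisect L0 gL e P0.
  have -> : g x - average P g =
    (g x - average (bisect P e) g) + (average (bisect P e) g - average P g) by ring.
  rewrite distrC => h; apply: le_trans (ler_normD _ _) _; by rewrite lerD2l.
- exact/mem_set.
Qed.

End oscillation.

Section weighted_poincare_real.
Context {R : realType} {n : nat}.
Local Notation mu := (lebesgue_rV R n).
Local Notation nu := (lebesgue_borel R n).
Local Notation leb := (caratheodory_type (nu^*)%mu).
Variables (p q r s rho : R) (Q : cube R n) (g w v : 'rV[R]_n -> R) (L : R).
Local Notation F := (grad_norm g).
Hypotheses (p_gt1 : 1 < p) (r_gt1 : 1 < r) (q_gt0 : 0 < q) (rho_gt0 : 0 < rho)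
  (pq_rho : q^-1 = p^-1 + rho^-1) (s_case : q <= 1 /\ s = 1 \/ 1 < q /\ s = r).
Hypotheses (Q0 : 0 < side Q) (L0 : 0 <= L) (gL : lipschitz_with L g)
  (mw : measurable_fun [set: leb] w) (mv : measurable_fun [set: leb] v)
  (w_gt0 : forall x, 0 < w x) (v_gt0 : forall x, 0 < v x)
  (iw : mu.-integrable (cube_set Q) (EFin \o (fun x => w x `^ (- (p / (p - 1) * r)))))
  (iv : mu.-integrable (cube_set Q) (EFin \o (fun x => v x `^ (q * s))))
  (ig : mu.-integrable (cube_set Q) (EFin \o (fun x => (w x * F x) `^ p))).

(** The price of the duality argument when [q > 1], see [powR_absorb]. *)
Definition absorb_const (q r : R) : R :=
  if q <= 1 then 1
  else carleson_const (q / (q - 1) / (q * r / (q * r - 1))) `^ (q - 1).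

Definition embed_const (p r : R) : R :=
  let sigma := p / (p - 1) * r in carleson_const (p / (sigma / (sigma - 1))).

Let s_ge1 : 1 <= s.
Proof. by case: s_case => -[_ ->] //; exact: ltW. Qed.

Let mF : measurable_fun [set: leb] F.
Proof. by apply: measurable_fun_lebesgue_rV; exact: measurable_grad_norm L0 gL. Qed.

Let iF : mu.-integrable (cube_set Q) (EFin \o F).
Proof. exact: integrable_grad_norm L0 gL _ Q0. Qed.

Lemma sparse_bound N :
  \int[mu]_(x in cube_set Q) (v x * sparse_fun Q F N x) `^ q <=
  absorb_const q r * sparse_sum p q r s Q F w v N.
Proof.
have F0 := @grad_norm_ge0 R n g; rewrite /absorb_const.
case: s_case => -[q1 sE].
  rewrite q1 mul1r; exact: (sparse_bound_le1 p_gt1 r_gt1 q_gt0 s_ge1 Q0 mF F0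
    mw mv w_gt0 v_gt0 iw iv ig N q1 sE).
rewrite (leNgt q 1) q1 /=; exact: (sparse_bound_gt1 p_gt1 r_gt1 q_gt0 s_ge1 Q0 mF F0 iF
    mw mv w_gt0 v_gt0 iw iv ig N q1 sE).
Qed.

Lemma absorb_const_gt0 : 0 < absorb_const q r.
Proof.
rewrite /absorb_const; have [//|q1] := leP q 1; apply: powR_gt0; apply: carleson_const_gt0.
have [t0 tq' _ _ _] := dual_exponents q1 r_gt1.
by rewrite ltr_pdivlMr ?mul1r.
Qed.

Lemma integrable_oscillation :
  mu.-integrable (cube_set Q) (EFin \o (fun x => (v x * `|g x - average Q g|) `^ q)).
Proof.
have K0 : 0 <= L * side Q by rewrite mulr_ge0// ltW.
apply: (@integrable_le_cube _ _ Q _ (fun x => (L * side Q) `^ q * v x `^ q)).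
- apply: measurable_powRc; apply: measurable_funM; first exact: mv.
  have mg : measurable_fun [set: leb] g.
    by apply: measurable_fun_lebesgue_rV; exact: lipschitz_measurable L0 gL.
  have mg1 : measurable_fun [set: leb] (fun x => g x - average Q g).
    by apply: measurable_funB; [exact: mg|exact: measurable_cst].
  exact: (measurableT_comp (@normr_measurable R setT) mg1).
- move=> x Qx; rewrite powR_ge0 /= -(powRM q K0 (ltW (v_gt0 x))).
  apply: ge0_ler_powR; rewrite ?nnegrE ?(ltW q_gt0)//.
  + by rewrite mulr_ge0// ltW.
  + by rewrite mulr_ge0// ltW.
  + rewrite mulrC; apply: ler_wpM2r; first exact: ltW.
    exact: (average_dist L0 gL Q0 Qx).
- exact: (integrableZl (measurable_cube_set Q) _
    (integrable_weight_powR q_gt0 s_ge1 Q0 mv v_gt0 iv)).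
Qed.

(** The factor [8 = 2 * 4] comes from [powRD_le] and [oscillation_le]; the term that the
    former adds vanishes as [N] grows. *)
Lemma weighted_poincare_real (A : R) :
  (forall N, \sum_(S <- stopping (@bisect R n) (average^~ F) N 0 Q)
     weight_term p q r s w v S `^ rho <= A) ->
  \int[mu]_(x in cube_set Q) (v x * `|g x - average Q g|) `^ q <=
  (8 * (n * 2 ^ n)%:R) `^ q * absorb_const q r *
  (A `^ (q / rho) *
   (embed_const p r * \int[mu]_(x in cube_set Q) (w x * F x) `^ p) `^ (q / p)).
Proof.
move=> HA; have F0 := @grad_norm_ge0 R n g.
set c : R := (n * 2 ^ n)%:R; have c_ge0 : 0 <= c by exact: ler0n.
set D := (embed_const _ _ * _) `^ _.
have D0 : 0 <= D by exact: powR_ge0.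
have bnd N : \int[mu]_(x in cube_set Q) (v x * sparse_fun Q F N x) `^ q <=
    absorb_const q r * (A `^ (q / rho) * D).
  apply: le_trans (sparse_bound N) _; rewrite ler_wpM2l ?(ltW absorb_const_gt0)//.
  apply: le_trans (sparse_sum_le s v p_gt1 r_gt1 q_gt0 rho_gt0 pq_rho Q0 mF F0 iF
    mw w_gt0 ig N) _.
  apply: ler_wpM2r => //; apply: ge0_ler_powR; rewrite ?nnegrE.
  - by rewrite divr_ge0 ?ltW.
  - by apply: sumr_ge0 => S _; exact: powR_ge0.
  - by apply: le_trans (HA N); apply: sumr_ge0 => S _; exact: powR_ge0.
  - exact: HA.
have ivq := integrable_weight_powR q_gt0 s_ge1 Q0 mv v_gt0 iv.
have isf N := integrable_sparse_fun q_gt0 s_ge1 Q0 F0 mv v_gt0 iv N.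
have mQ := measurable_cube_set Q.
apply: (@le_geometric_limit _ _ (2 `^ q * ((L * side Q) `^ q *
   \int[mu]_(x in cube_set Q) v x `^ q)) _ q q_gt0) => N.
pose e := (2 ^+ N)^-1 : R.
have e0 : 0 <= e by rewrite invr_ge0 exprn_ge0.
pose k1 := 2 `^ q * ((L * side Q) `^ q * e `^ q).
pose k2 := 2 `^ q * (4 * c) `^ q.
have ptw x : cube_set Q x -> (v x * `|g x - average Q g|) `^ q <=
    k1 * v x `^ q + k2 * (v x * sparse_fun Q F N x) `^ q.
  move=> Qx; have v0 := ltW (v_gt0 x).
  have S0 := sparse_fun_ge0 Q0 F0 N x.
  have := oscillation_le L0 gL N Q0 Qx.
  move: (sparse_fun _ _ _ _) S0 => S S0; rewrite -/c -/e => h.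
  have LQ : 0 <= L * side Q by rewrite mulr_ge0// ltW.
  have c4 : 0 <= 4 * c by rewrite mulr_ge0.
  have a0 : 0 <= L * side Q * e by rewrite mulr_ge0.
  apply: (@le_trans _ _ ((L * side Q * e * v x + 4 * c * (v x * S)) `^ q)).
    apply: ge0_ler_powR; rewrite ?nnegrE ?(ltW q_gt0)//.
    - by rewrite mulr_ge0.
    - exact: addr_ge0 (mulr_ge0 a0 v0) (mulr_ge0 c4 (mulr_ge0 v0 S0)).
    - apply: le_trans (ler_wpM2l v0 h) _.
      by rewrite le_eqVlt; apply/orP; left; apply/eqP; ring.
  apply: le_trans (powRD_le q_gt0 (mulr_ge0 a0 v0) (mulr_ge0 c4 (mulr_ge0 v0 S0))) _.
  rewrite (powRM q a0 v0) (powRM q LQ e0) (powRM q c4 (mulr_ge0 v0 S0)).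
  by rewrite /k1 /k2 le_eqVlt; apply/orP; left; apply/eqP; ring.
have i1 := integrableZl mQ k1 ivq.
have i2 := integrableZl mQ k2 (isf N).
apply: le_trans (le_Rintegral mQ integrable_oscillation (integrableD mQ i1 i2) ptw) _.
rewrite (RintegralD mQ i1 i2) (RintegralZl k1 mQ ivq) (RintegralZl k2 mQ (isf N)).
apply: lerD.
  by rewrite /k1 -/e le_eqVlt; apply/orP; left; apply/eqP; ring.
have -> : (8 * c) `^ q = k2.
  rewrite /k2 -(powRM q) ?mulr_ge0//; congr (_ `^ _); ring.
by rewrite -mulrA ler_wpM2l ?mulr_ge0 ?powR_ge0.
Qed.

End weighted_poincare_real.

(** * Weights and extended reals *)

Section weights.
Context {R : realType} {n : nat}.
Local Notation mu := (lebesgue_rV R n).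
Local Notation nu := (lebesgue_borel R n).
Local Notation leb := (caratheodory_type (nu^*)%mu).
Implicit Types (P Q S : cube R n) (phi psi : 'rV[R]_n -> R).

Lemma compact_cube_set P : compact (cube_set P).
Proof.
have -> : cube_set P = [set x | forall i,
    `[corner P ord0 i, corner P ord0 i + side P]%classic (x ord0 i)].
  by apply/seteqP; split=> x /= h i; have := h i; rewrite /= in_itv.
exact: (rV_compact (fun i => @segment_compact R _ _)).
Qed.

(** Weights are positive almost everywhere on the cube; changing them on
    a null set and outside the cube makes them positive and measurable on the whole
    space, with the same integrals over the cube. *)
Definition make_pos (E : set 'rV[R]_n) phi (x : 'rV[R]_n) : R :=
  if 0 < (phi \_ E) x then (phi \_ E) x else 1.

Lemma make_pos_gt0 E phi x : 0 < make_pos E phi x.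
Proof. by rewrite /make_pos; case: ifP. Qed.

Lemma make_posE (E : set 'rV[R]_n) phi x : E x -> 0 < phi x -> make_pos E phi x = phi x.
Proof. by move=> Ex px; rewrite /make_pos patchE mem_set// px. Qed.

Lemma measurable_make_pos P phi : measurable_fun (cube_set P : set leb) phi ->
  measurable_fun [set: leb] (make_pos (cube_set P) phi).
Proof.
move=> mphi; have m1 : measurable_fun [set: leb] (phi \_ (cube_set P)).
  exact/(measurable_restrictT _ (measurable_cube_set P)).1.
have m0 : measurable_fun [set: leb] (fun x => 0 < (phi \_ (cube_set P)) x).
  by apply: measurable_fun_ltr; [exact: measurable_cst|exact: m1].
have mc : measurable_fun [set: leb] (fun _ : leb => 1 : R) by exact: measurable_cst.
by have := measurable_fun_ifT m0 m1 mc.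
Qed.

(** Completeness of the measure carries measurability from [h2] over to [h1]. *)
Lemma ae_integral_cube Q P (h1 h2 : 'rV[R]_n -> \bar R) :
  cube_set P `<=` cube_set Q -> measurable_fun [set: leb] h2 ->
  {ae mu, forall x, cube_set Q x -> h1 x = h2 x} ->
  (\int[mu]_(x in cube_set P) h1 x = \int[mu]_(x in cube_set P) h2 x)%E.
Proof.
move=> PQ mh2 h12; have mP := measurable_cube_set P.
have mh2P : measurable_fun (cube_set P : set leb) h2 by exact: measurable_funTS.
have ae12 : ae_eq mu (cube_set P) h2 h1.
  apply: filterS h12; first exact: (ae_filter_ringOfSetsType mu).
  by move=> x h Px; rewrite h//; exact: PQ.
apply: ae_eq_integral => //; last exact: ae_eq_sym.
by apply: ae_measurable_fun ae12 mh2P; exact: measure_is_complete_caratheodory.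
Qed.

Lemma integral_cube_gt0 P phi : 0 < side P -> measurable_fun [set: leb] phi ->
  (forall x, 0 < phi x) -> (0 < \int[mu]_(x in cube_set P) (phi x)%:E)%E.
Proof.
move=> P0 mphi phi0; rewrite lt_def integral_ge0 ?andbT; last first.
  by move=> x _; rewrite lee_fin ltW.
apply/eqP => H; have mP := measurable_cube_set P.
have mphiE : measurable_fun (cube_set P : set leb) (EFin \o phi).
  by apply/measurable_EFinP; exact: measurable_funTS.
have [Z _] := ae_eq_integral_abs mu mP mphiE.
have {}Z : ae_eq mu (cube_set P) (EFin \o phi) (cst 0%E).
  apply: Z; rewrite -[RHS]H; apply: eq_integral => x _ /=.
  by rewrite ger0_norm// ltW.
have : mu.-negligible (cube_set P).
  apply: negligibleS Z => x Px /= h; have := h Px => -[] h0.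
  by have := phi0 x; rewrite h0 ltxx.
move=> /(negligibleP mu mP) h.
have := volume_gt0 P0; rewrite -lte_fin EFin_volume//.
by rewrite [X in (_ < X)%E]h ltxx.
Qed.

Lemma eaverageE P phi : mu.-integrable (cube_set P) (EFin \o phi) ->
  eaverage P (fun x => (phi x)%:E) = (average P phi)%:E.
Proof. by move=> iphi; rewrite /eaverage -EFin_Rintegral. Qed.

Lemma eaverage_gt0 P phi : 0 < side P -> measurable_fun [set: leb] phi ->
  (forall x, 0 < phi x) -> (0 < eaverage P (fun x => (phi x)%:E))%E.
Proof.
move=> P0 mphi phi0; apply: mule_gt0; first by rewrite lte_fin invr_gt0 volume_gt0.
exact: integral_cube_gt0.
Qed.

Lemma eaverage_lty P phi : 0 < side P -> measurable_fun [set: leb] phi ->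
  (forall x, 0 < phi x) -> (eaverage P (fun x => (phi x)%:E) < +oo)%E ->
  mu.-integrable (cube_set P) (EFin \o phi).
Proof.
move=> P0 mphi phi0; have V0 : (0 < (volume P)^-1%:E)%E.
  by rewrite lte_fin invr_gt0 volume_gt0.
rewrite /eaverage => h; apply/integrableP; split.
  by apply/measurable_EFinP; exact: measurable_funTS.
rewrite (eq_integral (fun x : leb => (phi x)%:E)); last first.
  by move=> x _; rewrite /= ger0_norm// ltW.
rewrite ltey; apply/eqP => I; move: h; rewrite I gt0_muley//.
Qed.

Section A_const.
Variables (p q r s rho : R) (Q : cube R n).
Hypotheses (p_gt1 : 1 < p) (r_gt1 : 1 < r) (q_gt0 : 0 < q) (s_gt0 : 0 < s)
  (rho_gt0 : 0 < rho) (Q0 : 0 < side Q).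

Lemma eq_A_const (w v w' v' : 'rV[R]_n -> R) :
  measurable_fun [set: leb] w' -> measurable_fun [set: leb] v' ->
  {ae mu, forall x, cube_set Q x -> w x = w' x} ->
  {ae mu, forall x, cube_set Q x -> v x = v' x} ->
  A_const p q r s rho Q w v = A_const p q r s rho Q w' v'.
Proof.
move=> mw' mv' aew aev; apply: (congr1 (fun z : \bar R => z `^ rho^-1)%E).
apply: eq_esum => P QP; have PQ := dyadic_cube_set QP Q0.
have E (k k' : 'rV[R]_n -> R) a : measurable_fun [set: leb] k' ->
    {ae mu, forall x, cube_set Q x -> k x = k' x} ->
    eaverage P (fun x => (k x `^ a)%:E) = eaverage P (fun x => (k' x `^ a)%:E).
  move=> mk' aek; apply: (congr1 (fun z : \bar R => (volume P)^-1%:E * z)%E).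
  apply: ae_integral_cube PQ _ _.
    by apply/measurable_EFinP; exact: measurable_powRc.
  apply: filterS aek; first exact: (ae_filter_ringOfSetsType mu).
  by move=> x h Qx; rewrite h.
by rewrite (E w w' _ mw' aew) (E v v' _ mv' aev).
Qed.

Variables w v : 'rV[R]_n -> R.
Hypotheses (mw : measurable_fun [set: leb] w) (mv : measurable_fun [set: leb] v)
  (w_gt0 : forall x, 0 < w x) (v_gt0 : forall x, 0 < v x).
Local Notation sigma := (p / (p - 1) * r).

(** The term of [Q] itself is a product of positive factors, so if the sum is finite each
    of the factors is. The sparse families are among the finite sets of dyadic cubes over
    which the sum is taken. *)
Lemma A_const_lty : (A_const p q r s rho Q w v < +oo)%E ->
  [/\ mu.-integrable (cube_set Q) (EFin \o (fun x => w x `^ (- sigma))),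
      mu.-integrable (cube_set Q) (EFin \o (fun x => v x `^ (q * s))) &
      exists2 A, 0 < A & A_const p q r s rho Q w v = (A `^ rho^-1)%:E /\
        forall t : seq (cube R n), uniq t -> (forall S, S \in t -> dyadic Q S) ->
          \sum_(S <- t) weight_term p q r s w v S `^ rho <= A].
Proof.
rewrite /A_const; set term := (X in esum _ X); set T := esum _ _ => Tlt.
have rho_neq0 : rho != 0 by rewrite gt_eqF.
have sigma0 : 0 < sigma.
  by rewrite mulr_gt0 ?divr_gt0 ?subr_gt0 ?(lt_trans ltr01).
have qs0 : 0 < q * s by rewrite mulr_gt0.
have {}Tlt : (T < +oo)%E by apply: lty_poweRy Tlt; rewrite invr_neq0.
have mwp : measurable_fun [set: leb] (fun x => w x `^ (- sigma)).
  exact: measurable_powRc.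
have mvp : measurable_fun [set: leb] (fun x => v x `^ (q * s)).
  exact: measurable_powRc.
have wp0 x : 0 < w x `^ (- sigma) by exact: powR_gt0.
have vp0 x : 0 < v x `^ (q * s) by exact: powR_gt0.
have le_T (t : seq (cube R n)) : uniq t -> (forall S, S \in t -> dyadic Q S) ->
    (\sum_(S <- t) term S <= T)%E.
  move=> ut tQ; apply: esum_ge; exists [set` t]; last by rewrite fsbig_seq.
  by split; [exact: finite_seq|move=> S; exact: tQ].
have termQ : (term Q <= T)%E.
  have := le_T [:: Q] isT; rewrite big_seq1; apply.
  by move=> S; rewrite inE => /eqP ->; exact: dyadic_refl.
have coef0 : (0 < (side Q / volume Q `^ (p^-1 - q^-1))%:E)%E.
  rewrite lte_fin; apply: divr_gt0; first exact: Q0.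
  by apply: powR_gt0; exact: volume_gt0.
have W0 := poweR_gt0 sigma^-1 (eaverage_gt0 Q0 mwp wp0).
have V0 := poweR_gt0 (q * s)^-1 (eaverage_gt0 Q0 mvp vp0).
have term_gt0 : (0 < term Q)%E.
  by apply: poweR_gt0; apply: mule_gt0 V0; apply: mule_gt0.
have Q_lt := lty_poweRy rho_neq0 (le_lt_trans termQ Tlt).
have iw : mu.-integrable (cube_set Q) (EFin \o (fun x => w x `^ (- sigma))).
  apply: eaverage_lty => //; rewrite ltey; apply/eqP => Woo; move: Q_lt.
  rewrite Woo poweRyr ?invr_neq0 ?gt_eqF//.
  by rewrite (gt0_muley coef0) gt0_mulye.
have iv : mu.-integrable (cube_set Q) (EFin \o (fun x => v x `^ (q * s))).
  apply: eaverage_lty => //; rewrite ltey; apply/eqP => Voo; move: Q_lt.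
  rewrite Voo poweRyr ?invr_neq0 ?gt_eqF//.
  by rewrite gt0_muley// mule_gt0.
have termE S : dyadic Q S -> term S = (weight_term p q r s w v S `^ rho)%:E.
  move=> QS; rewrite /term /weight_term !eaverageE; last 2 first.
  - exact: integrable_cube_le Q0 QS iv.
  - exact: integrable_cube_le Q0 QS iw.
  move: (average S _) (average S _) (_ / _) => W V c.
  by rewrite (poweR_EFin W) (poweR_EFin V) -(EFinM c) -EFinM poweR_EFin.
have T0 : (0 < T)%E by apply: lt_le_trans termQ.
have Tfin : T \is a fin_num by rewrite ge0_fin_numE// ltW.
split=> //; exists (fine T); first by apply: fine_gt0; rewrite T0.
split; first by rewrite -poweR_EFin fineK.
move=> t ut tQ; rewrite -lee_fin fineK//; apply: le_trans (le_T t ut tQ).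
rewrite -sumEFin !big_seq; apply: lee_sum => S St.
by rewrite termE//; exact: tQ.
Qed.

End A_const.
End weights.

(** * The weighted Poincare inequality *)

Section main.
Context {R : realType} {n : nat}.
Local Notation mu := (lebesgue_rV R n).
Local Notation nu := (lebesgue_borel R n).
Local Notation leb := (caratheodory_type (nu^*)%mu).

Lemma powR_root (p q rho X Y A c K E : R) : 0 < q -> 0 <= X -> 0 <= c -> 0 <= K ->
  0 <= A -> 0 <= E -> 0 <= Y ->
  X <= c `^ q * K * (A `^ (q / rho) * (E * Y) `^ (q / p)) ->
  X `^ q^-1 <= (c * K `^ q^-1 * E `^ p^-1) * A `^ rho^-1 * Y `^ p^-1.
Proof.
move=> q0 X0 c0 K0 A0 E0 Y0 h.
have cq0 : 0 <= c `^ q * K by rewrite mulr_ge0 ?powR_ge0.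
have EY0 : 0 <= E * Y by rewrite mulr_ge0.
have AE0 : 0 <= A `^ (q / rho) * (E * Y) `^ (q / p) by rewrite mulr_ge0 ?powR_ge0.
have : X `^ q^-1 <= (c `^ q * K * (A `^ (q / rho) * (E * Y) `^ (q / p))) `^ q^-1.
  apply: ge0_ler_powR h; rewrite ?nnegrE ?invr_ge0 ?(ltW q0)//.
  exact: mulr_ge0.
rewrite (powRM q^-1 cq0 AE0) (powRM q^-1 (powR_ge0 c q) K0) (powRKV c0 q0).
rewrite (powRM q^-1 (powR_ge0 A _) (powR_ge0 (E * Y) _)).
have cancel z : q * z * q^-1 = z by rewrite mulrAC mulfV ?mul1r ?gt_eqF.
rewrite -(powRrM A) -(powRrM (E * Y)) !cancel.
rewrite (powRM p^-1 E0 Y0); move/le_trans; apply.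
by rewrite le_eqVlt; apply/orP; left; apply/eqP; ring.
Qed.

Variables (p q r s rho : R).
Hypotheses (n_gt0 : (0 < n)%N) (p_gt1 : 1 < p) (r_gt1 : 1 < r) (q_gt0 : 0 < q)
  (rho_gt0 : 0 < rho) (pq_rho : q^-1 = p^-1 + rho^-1)
  (s_case : q <= 1 /\ s = 1 \/ 1 < q /\ s = r).

Definition poincare_const : R :=
  8 * (n * 2 ^ n)%:R * absorb_const q r `^ q^-1 * embed_const p r `^ p^-1.

Lemma embed_const_gt0 : 0 < embed_const p r.
Proof.
have [_ k0 kp _] := weight_exponents p_gt1 r_gt1.
by apply: carleson_const_gt0; rewrite ltr_pdivlMr ?mul1r.
Qed.

Lemma poincare_const_gt0 : 0 < poincare_const.
Proof.
rewrite /poincare_const; apply: mulr_gt0; last exact/powR_gt0/embed_const_gt0.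
apply: mulr_gt0; last exact/powR_gt0/absorb_const_gt0.
by rewrite mulr_gt0// ltr0n muln_gt0 n_gt0 expn_gt0.
Qed.

Lemma Lq_norm_cube (Q : cube R n) (a : R) (h k : 'rV[R]_n -> R) : 0 < a ->
  measurable_fun [set: leb] k ->
  {ae mu, forall x, cube_set Q x -> `|h x| = k x} ->
  Lq_norm a (cube_set Q) h =
  ((\int[mu]_(x in cube_set Q) (k x `^ a)%:E) `^ a^-1)%E.
Proof.
move=> a0 mk hk; apply: etrans (Lnorm_cube _ _ a0) _.
apply: (congr1 (fun z : \bar R => z `^ a^-1)%E).
apply: (@ae_integral_cube R n Q Q) => //.
  by apply/measurable_EFinP; exact: measurable_powRc.
apply: filterS hk; first exact: (ae_filter_ringOfSetsType mu).
by move=> x h' Qx; rewrite h'.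
Qed.

Lemma weight_make_pos (Q : cube R n) (w : 'rV[R]_n -> R) : weight (cube_set Q) w ->
  measurable_fun [set: leb] (make_pos (cube_set Q) w) /\
  {ae mu, forall x, cube_set Q x -> w x = make_pos (cube_set Q) w x}.
Proof.
move=> [iw w_pos]; split.
  apply: measurable_make_pos; apply/measurable_EFinP.
  apply: (@measurable_int _ _ _ mu).
  by apply: iw; [exact: compact_cube_set|].
apply: filterS w_pos; first exact: (ae_filter_ringOfSetsType mu).
by move=> x h Qx; rewrite make_posE//; have [] := h Qx.
Qed.

(** The two weight classes differ in the exponent [s] only, so one statement covers
    both ranges of [q]. *)
Lemma weighted_poincare (Q : cube R n) (f w v : 'rV[R]_n -> R) :
  0 < side Q -> [lipschitz f x | x in cube_set Q] ->
  A_class p q r s rho Q w v ->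
  (Lq_norm q (cube_set Q) (fun x => (v x * (f x - average Q f))%R)
   <= poincare_const%:E * A_const p q r s rho Q w v
      * Lq_norm p (cube_set Q) (fun x => (w x * norm_grad f x)%R))%E.
Proof.
move=> Q0 lipf [weight_w weight_v A_fin].
have p_gt0 : 0 < p by exact: lt_trans ltr01 p_gt1.
have s_gt0 : 0 < s by case: s_case => -[_ ->] //; exact: lt_trans ltr01 r_gt1.
have [g [L L0 [gL gf]]] := lipschitz_extension Q0 lipf.
have [mw aew] := weight_make_pos weight_w.
have [mv aev] := weight_make_pos weight_v.
move: A_fin; rewrite (eq_A_const _ _ _ _ _ Q0 mw mv aew aev).
have w_gt0 := @make_pos_gt0 R n (cube_set Q) w.
have v_gt0 := @make_pos_gt0 R n (cube_set Q) v.
move: (make_pos _ w) (make_pos _ v) mw mv aew aev w_gt0 v_gt0.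
move=> w' v' mw mv aew aev w_gt0 v_gt0 A_fin.
have [iw iv [A A0 [AE sumA]]] := A_const_lty p_gt1 r_gt1 q_gt0 s_gt0 rho_gt0 Q0
  mw mv w_gt0 v_gt0 A_fin.
have mg : measurable_fun [set: leb] g.
  by apply: measurable_fun_lebesgue_rV; exact: lipschitz_measurable L0 gL.
have mG : measurable_fun [set: leb] (grad_norm g).
  by apply: measurable_fun_lebesgue_rV; exact: measurable_grad_norm L0 gL.
have G0 := @grad_norm_ge0 R n g.
have mosc : measurable_fun [set: leb] (fun x => `|g x - average Q g|).
  have m1 : measurable_fun [set: leb] (fun x => g x - average Q g).
    by apply: measurable_funB; [exact: mg|exact: measurable_cst].
  exact: (measurableT_comp (@normr_measurable R setT) m1).
have avgE : average Q f = average Q g.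
  rewrite /average; congr (_ * _); apply: eq_Rintegral => x Qx.
  by rewrite gf//; exact: set_mem.
rewrite (Lq_norm_cube (k := fun x => v' x * `|g x - average Q g|) q_gt0); first last.
- apply: filterS aev; first exact: (ae_filter_ringOfSetsType mu).
  by move=> x h Qx; rewrite normrM h// (gtr0_norm (v_gt0 x)) avgE gf.
- by apply: measurable_funM; [exact: mv|exact: mosc].
rewrite (Lq_norm_cube (k := fun x => w' x * grad_norm g x) p_gt0); first last.
- apply: filterS2 aew (ae_norm_grad Q0 L0 gL gf);
    first exact: (ae_filter_ringOfSetsType mu).
  move=> x h1 h2 Qx; rewrite normrM h1// (gtr0_norm (w_gt0 x)) h2//.
  by rewrite ger0_norm.
- by apply: measurable_funM; [exact: mw|exact: mG].
have mwG : measurable_fun [set: leb] (fun x => (w' x * grad_norm g x) `^ p).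
  by apply: measurable_powRc; apply: measurable_funM; [exact: mw|exact: mG].
have C0 := poincare_const_gt0.
rewrite AE; set Y := (\int[mu]_(x in _) ((w' x * _) `^ p)%:E)%E.
have [Yoo|Yfin] := eqVneq Y +oo%E.
  rewrite Yoo poweRyr ?invr_neq0 ?gt_eqF// gt0_muley ?leey//.
  by apply: mule_gt0; rewrite lte_fin// powR_gt0.
have ig : mu.-integrable (cube_set Q) (EFin \o (fun x => (w' x * grad_norm g x) `^ p)).
  apply/integrableP; split.
    by apply/measurable_EFinP; exact: measurable_funTS.
  rewrite (eq_integral (fun x : leb => ((w' x * grad_norm g x) `^ p)%:E)); last first.
    by move=> x _; rewrite /= ger0_norm// powR_ge0.
  by rewrite -/Y ltey.
have main := @weighted_poincare_real R n p q r s rho Q g w' v' L p_gt1 r_gt1 q_gt0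
  rho_gt0 pq_rho s_case Q0 L0 gL mw mv w_gt0 v_gt0 iw iv ig A.
rewrite -(EFin_Rintegral (integrable_oscillation r_gt1 q_gt0 s_case Q0 L0 gL mv v_gt0 iv)).
rewrite /Y -(EFin_Rintegral ig) !poweR_EFin -!EFinM lee_fin.
apply: (@powR_root p q rho) => //.
- by apply: Rintegral_ge0 => x _; exact: powR_ge0.
- by apply/ltW/absorb_const_gt0.
- exact: ltW.
- exact/ltW/embed_const_gt0.
- by apply: Rintegral_ge0 => x _; exact: powR_ge0.
- apply: main => N; apply: sumA; first exact: stopping_uniq.
  by move=> S; exact: stopping_dyadic.
Qed.

End main.

Theorem theorem3p2 (R : realType) (n : nat) (p q r rho : R)
    (n_gt0 : (0 < n)%N) (p_gt1 : 1 < p) (r_gt1 : 1 < r)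
    (q_gt0 : 0 < q) (rho_gt0 : 0 < rho) (q_lt_p : q < p)
    (pq_rho : q^-1 = p^-1 + rho^-1) :
  exists2 C : R, 0 < C &
    forall (Q : cube R n) (f : 'rV[R]_n -> R),
      0 < side Q -> [lipschitz f x | x in cube_set Q] ->
      (1 < q -> forall w v : 'rV[R]_n -> R, A_class p q r r rho Q w v ->
         (Lq_norm q (cube_set Q) (fun x => (v x * (f x - average Q f))%R)
          <= C%:E * A_const p q r r rho Q w v
             * Lq_norm p (cube_set Q) (fun x => (w x * norm_grad f x)%R))%E)
      /\
      (q <= 1 -> forall w v : 'rV[R]_n -> R, A_class p q r 1 rho Q w v ->
         (Lq_norm q (cube_set Q) (fun x => (v x * (f x - average Q f))%R)
          <= C%:E * A_const p q r 1 rho Q w v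
             * Lq_norm p (cube_set Q) (fun x => (w x * norm_grad f x)%R))%E).
Proof.
exists (@poincare_const R n p q r) => [|Q f Q0 lipf]; first exact: poincare_const_gt0.
split=> hq w v; apply: weighted_poincare => //; [by right|by left].
Qed.
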